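(* Let $A\in\mathbb R^{n\times n}$, $B\in\mathbb R^{n\times p}$, and let $Q\in\mathbb R^{n\times n}$, $R\in\mathbb R^{p\times p}$ be symmetric positive definite. Let $J_\star$ denote the minimal LQR cost achievable by any controller for the dynamical system with transition matrices $(A,B)$, and let $K_\star$ denote the optimal controller (a static gain). Let $(\widehat A,\widehat B)$ be estimates of the transition matrices such that $\Delta_A:=\widehat A-A$ and $\Delta_B:=\widehat B-B$ satisfy $\|\Delta_A\|_2\le\epsilon_A$ and $\|\Delta_B\|_2\le\epsilon_B$. Let $\mathbf K=\mathbf\Phi_u\mathbf\Phi_x^{-1}$, where $(\gamma,\mathbf\Phi_x,\mathbf\Phi_u)$ is an optimal solution with $\alpha=1/2$ of $$\min_{\gamma\in[0,1)}\frac1{1-\gamma}\min_{\mathbf\Phi_x,\mathbf\Phi_u}\left\|\begin{bmatrix}Q^{1/2}&0\\0&R^{1/2}\end{bmatrix}\begin{bmatrix}\mathbf\Phi_x\\ \mathbf\Phi_u\end{bmatrix}\right\|_{\mathcal H_2}$$ $$\text{s.t. }\begin{bmatrix}zI-\widehat A&-\widehat B\end{bmatrix}\begin{bmatrix}\mathbf\Phi_x\\ \mathbf\Phi_u\end{bmatrix}=I,\quad\left\|\begin{bmatrix}\frac{\epsilon_A}{\sqrt\alpha}\mathbf\Phi_x\\ \frac{\epsilon_B}{\sqrt{1-\alpha}}\mathbf\Phi_u\end{bmatrix}\right\|_{\mathcal H_\infty}\le\gamma,\quad\mathbf\Phi_x,\mathbf\Phi_u\in\tfrac1z\mathcal{RH}_\infty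 .$$ Then, as long as $(\epsilon_A+\epsilon_B\|K_\star\|_2)\,\|\mathfrak R_{A+BK_\star}\|_{\mathcal H_\infty}\le 1/5$, the relative error in the LQR cost satisfies $$\frac{J(A,B,\mathbf K)-J_\star}{J_\star}\le 5\,(\epsilon_A+\epsilon_B\|K_\star\|_2)\,\|\mathfrak R_{A+BK_\star}\|_{\mathcal H_\infty}.$$
   Context: Transfer functions are real-rational matrix functions of $z$. $\mathcal{RH}_\infty$ is the set of proper ones with all poles in the open unit disk; $\frac1z\mathcal{RH}_\infty$ is its subset of strictly proper ones. With $\mathbb T$ the unit circle, $\|\mathbf G\|_{\mathcal H_\infty}=\sup_{z\in\mathbb T}\|\mathbf G(z)\|_2$ and $\|\mathbf G\|_{\mathcal H_2}=\big(\frac1{2\pi}\int_{-\pi}^{\pi}\|\mathbf G(e^{i\theta})\|_F^2\,d\theta\big)^{1/2}$; $\|\cdot\|_2$ on constant matrices is the spectral norm. $\mathfrak R_M:=(zI-M)^{-1}$. For the system $x_{t+1}=Ax_t+Bu_t+w_t$, a controller $\mathbf u=\mathbf K\mathbf x$ (proper real-rational $\mathbf K$, possibly static) stabilizes $(A,B)$ if its system response $\mathbf\Psi_x=(zI-A-B\mathbf K)^{-1}$, $\mathbf\Psi_u=\mathbf K(zI-A-B\mathbf K)^{-1}$ lies in $\frac1z\mathcal{RH}_\infty$ (equivalent to internal stability). For stabilizing $\mathbf K$ the LQR cost is, by the paper's convention (noise variance factor dropped, not squared), $J(A,B,\mathbf K)=\left\|\begin{bmatrix}Q^{1/2}&0\\0&R^{1/2}\end{bmatrix}\begin{bmatrix}\mathbf\Psi_x\\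 \mathbf\Psi_u\end{bmatrix}\right\|_{\mathcal H_2}$; otherwise it is $+\infty$. $J_\star=\min_{\mathbf K}J(A,B,\mathbf K)$ is attained by the static stabilizing gain $K_\star\in\mathbb R^{p\times n}$ (assumed to exist). *)

(* Defs.v *)
From HB Require Import structures.
From mathcomp Require Import all_boot all_order all_algebra.
From mathcomp Require Import complex.
From mathcomp Require Import all_classical all_reals all_analysis.

Set Implicit Arguments.
Unset Strict Implicit.
Unset Printing Implicit Defensive.

Import Order.TTheory GRing.Theory Num.Theory.

Local Open Scope classical_set_scope.
Local Open Scope ring_scope.

Section ComplexMatrixNorms.
Variable R : realType.

Definition cabs (z : R[i]) : R := complex.Re `|z|.

Definition fronorm m n (M : 'M[R[i]]_(m, n)) : R :=
  Num.sqrt (\sum_i \sum_j cabs (M i j) ^+ 2).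

(* On a column vector, [fronorm] is the Euclidean norm. *)
Definition specnorm m n (M : 'M[R[i]]_(m, n)) : R :=
  sup [set fronorm (M *m v) | v in [set v : 'cV[R[i]]_n | fronorm v <= 1]].

(* A real matrix and its complexification have the same singular values, hence
   the same spectral norm. *)
Definition rspecnorm m n (M : 'M[R]_(m, n)) : R :=
  specnorm (map_mx (real_complex R) M).

End ComplexMatrixNorms.

Section PositiveDefinite.
Variable R : realType.

Definition posdefmx n (Q : 'M[R]_n) : Prop :=
  Q^T = Q /\ forall x : 'cV[R]_n, x != 0 -> 0 < (x^T *m Q *m x) 0 0.

Definition possemidefmx n (Q : 'M[R]_n) : Prop :=
  Q^T = Q /\ forall x : 'cV[R]_n, 0 <= (x^T *m Q *m x) 0 0.

(* The positive semidefinite square root; it exists and is unique whenever [Q]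
   is positive semidefinite. *)
Definition sqrtmx n (Q : 'M[R]_n) : 'M[R]_n :=
  xget 0 [set S | possemidefmx S /\ S *m S = Q].

End PositiveDefinite.

Section TransferFunctions.
Variable R : realType.

Definition ratfun := {fraction {poly R}}.

Definition zvar : ratfun := FracField.tofrac 'X.

Definition ratC (a : R) : ratfun := FracField.tofrac a%:P.

Definition constmx m n (M : 'M[R]_(m, n)) : 'M[ratfun]_(m, n) := map_mx ratC M.

(* Numerator and denominator in lowest terms, up to a common nonzero scalar. *)
Definition ratnum (f : ratfun) : {poly R} :=
  (frac (repr f)).1 %/ gcdp (frac (repr f)).1 (frac (repr f)).2.
Definition ratden (f : ratfun) : {poly R} :=
  (frac (repr f)).2 %/ gcdp (frac (repr f)).1 (frac (repr f)).2.

Definition ratpole (f : ratfun) (z : R[i]) : Prop :=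
  root (map_poly (real_complex R) (ratden f)) z.

(* Meaningful only away from the poles of [f]. *)
Definition rateval (f : ratfun) (z : R[i]) : R[i] :=
  (map_poly (real_complex R) (ratnum f)).[z] /
  (map_poly (real_complex R) (ratden f)).[z].

Definition evalmx m n (G : 'M[ratfun]_(m, n)) (z : R[i]) : 'M[R[i]]_(m, n) :=
  map_mx (fun f => rateval f z) G.

Definition proper m n (G : 'M[ratfun]_(m, n)) : Prop :=
  forall i j, (size (ratnum (G i j)) <= size (ratden (G i j)))%N.

Definition strictly_proper m n (G : 'M[ratfun]_(m, n)) : Prop :=
  forall i j, (size (ratnum (G i j)) < size (ratden (G i j)))%N.

Definition RHoo m n (G : 'M[ratfun]_(m, n)) : Prop :=
  proper G /\ forall i j (z : R[i]), ratpole (G i j) z -> cabs z < 1.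

Definition zinvRHoo m n (G : 'M[ratfun]_(m, n)) : Prop :=
  RHoo G /\ strictly_proper G.

(* Both norms are used only for transfer matrices without poles on the unit
   circle, where the supremum and the integral below are finite. *)
Definition Hoonorm m n (G : 'M[ratfun]_(m, n)) : R :=
  sup [set specnorm (evalmx G z) | z in [set z : R[i] | cabs z = 1]].

Definition H2norm m n (G : 'M[ratfun]_(m, n)) : R :=
  Num.sqrt ((2 * pi)^-1 * \int[lebesgue_measure]_(t in `[- pi, pi])
    fronorm (evalmx G (Complex (cos t) (sin t))) ^+ 2).

End TransferFunctions.

Section LQR.
Variables (R : realType) (n p : nat).
Implicit Types (A : 'M[R]_n) (B : 'M[R]_(n, p)) (Q : 'M[R]_n) (Rw : 'M[R]_p).
Implicit Types (K : 'M[ratfun R]_(p, n)).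
Implicit Types (Phix : 'M[ratfun R]_n) (Phiu : 'M[ratfun R]_(p, n)).

Definition zIminus (M : 'M[ratfun R]_n) : 'M[ratfun R]_n := (zvar R)%:M - M.

Definition resolvent A : 'M[ratfun R]_n := invmx (zIminus (constmx A)).

Definition closed_loop A B K : 'M[ratfun R]_n :=
  zIminus (constmx A + constmx B *m K).
Definition response_x A B K : 'M[ratfun R]_n := invmx (closed_loop A B K).
Definition response_u A B K : 'M[ratfun R]_(p, n) := K *m response_x A B K.

(* [invmx] is the identity on singular matrices; the invertibility condition,
   which every proper [K] satisfies, makes [response_x] a genuine inverse. *)
Definition stabilizes A B K : Prop :=
  [/\ proper K, closed_loop A B K \in unitmx,
      zinvRHoo (response_x A B K) & zinvRHoo (response_u A B K)].

Definition weighted_H2 Q Rw Phix Phiu : R :=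
  H2norm (constmx (block_mx (sqrtmx Q) 0 0 (sqrtmx Rw)) *m col_mx Phix Phiu).

Definition lqr_cost Q Rw A B K : \bar R :=
  if `[< stabilizes A B K >]
  then (weighted_H2 Q Rw (response_x A B K) (response_u A B K))%:E
  else +oo%E.

Definition lqr_opt Q Rw A B : \bar R :=
  ereal_inf [set lqr_cost Q Rw A B K | K in [set K | proper K]].

Definition robust_feasible A B (epsA epsB alpha gamma : R) Phix Phiu : Prop :=
  [/\ row_mx (zIminus (constmx A)) (- constmx B) *m col_mx Phix Phiu = 1%:M,
      Hoonorm (col_mx (ratC (epsA / Num.sqrt alpha) *: Phix)
                      (ratC (epsB / Num.sqrt (1 - alpha)) *: Phiu)) <= gamma,
      zinvRHoo Phix & zinvRHoo Phiu].

(* Value of the inner problem for fixed [gamma]; [+oo] if infeasible. *)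
Definition robust_value Q Rw A B (epsA epsB alpha gamma : R) : \bar R :=
  ereal_inf [set (weighted_H2 Q Rw Phi.1 Phi.2)%:E |
    Phi in [set Phi : 'M[ratfun R]_n * 'M[ratfun R]_(p, n) |
      robust_feasible A B epsA epsB alpha gamma Phi.1 Phi.2]].

(* [(Phix, Phiu)] attains the inner minimum at [gamma], and [gamma] attains the
   outer one. *)
Definition robust_optimal Q Rw A B (epsA epsB alpha gamma : R) Phix Phiu : Prop :=
  [/\ 0 <= gamma < 1,
      robust_feasible A B epsA epsB alpha gamma Phix Phiu,
      (weighted_H2 Q Rw Phix Phiu)%:E
        = robust_value Q Rw A B epsA epsB alpha gamma &
      forall gamma' : R, 0 <= gamma' < 1 ->
        (((1 - gamma)^-1)%:E * robust_value Q Rw A B epsA epsB alpha gamma <=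
         ((1 - gamma')^-1)%:E * robust_value Q Rw A B epsA epsB alpha gamma')%E].

End LQR.

(* Main.v *)
Require Import Defs.
From mathcomp Require Import all_boot all_order all_algebra perm.
From mathcomp Require Import complex ring lra.
From mathcomp Require Import all_classical all_reals all_analysis.

Set Implicit Arguments.
Unset Strict Implicit.
Unset Printing Implicit Defensive.

Import Order.TTheory GRing.Theory Num.Theory.
Import numFieldNormedType.Exports.
Local Open Scope classical_set_scope.
Local Open Scope ring_scope.

(** If the perturbation [D] of the affine constraint has [Hoo] norm at most
    [g < 1], then [1 + D] has a stable inverse (small gain), which multiplies
    the responses designed for [(Ahat, Bhat)] to give the true closed-loop
    responses; the cost grows by at most [1 / (1 - g)].  Applied to the optimal
    solution this bounds [J(A, B, K)] by [1 / (1 - gamma)] times the optimal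
    value; applied to the static gain [Kstar], with
    [eta = (epsA + epsB |Kstar|) |resolvent|_oo], it yields a competitor that is
    feasible at [gamma0 = sqrt 2 * eta / (1 - eta)] and costs at most
    [J_star / (1 - eta)].  Hence [J <= J_star / (1 - (1 + sqrt 2) eta)], which is
    at most [(1 + 5 eta) J_star] when [eta <= 1/5].

    Small gain rests on the maximum modulus principle outside the unit disk for
    the scalar rational functions [v^* D(z) v]. *)

(** A transfer function is a formal fraction whose numerator and denominator are read off an
    arbitrary representative, so sums, products and inverses do not visibly commute with evaluation.
    The remedy is to see stability and properness as integrality: a fraction is regular at a point
    [z], or at infinity, when it lies in a valuation ring there. Ring operations and determinants
    then pass to the values, and a matrix with invertible value has a regular inverse. At infinity
    [1 + M] has value 1 when [M] is strictly proper; at points with [1 <= cabs z] its value is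
    invertible by small gain.

    The spectral norm is not the modulus of a holomorphic function, which is why forms with a fixed
    vector replace the matrix in the maximum principle.

    The factor [sqrt 2] is the price of [alpha = 1/2]. Both blocks of the constraint carry it. This
    bounds [|D|] by [gamma] through [(a + b)^2 <= 2 a^2 + 2 b^2], but for the static gain
    [2 (a^2 + b^2)] has to be estimated by [2 (a + b)^2], since [eta] contains the sum
    [epsA + epsB |Kstar|]. The constant 5 is admissible because [sqrt 2 <= 3/2]. *)

Section EuclideanNorms.
Variable R : realType.
Implicit Types (z w : R[i]).

(** * Modulus, Frobenius norm and spectral norm over the complex numbers *)

Lemma cabsE z : cabs z = Num.sqrt (complex.Re z ^+ 2 + complex.Im z ^+ 2).
Proof. by case: z. Qed.

Lemma sqr_cabs z : cabs z ^+ 2 = complex.Re z ^+ 2 + complex.Im z ^+ 2.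
Proof. by rewrite cabsE sqr_sqrtr // addr_ge0 // sqr_ge0. Qed.

Lemma cabs_ge0 z : 0 <= cabs z.
Proof. by rewrite cabsE sqrtr_ge0. Qed.

Lemma cabs0 : cabs (0 : R[i]) = 0.
Proof. by rewrite cabsE /= expr0n addr0 sqrtr0. Qed.

Lemma cabs1 : cabs (1 : R[i]) = 1.
Proof. by rewrite cabsE /= expr0n addr0 expr1n sqrtr1. Qed.

Lemma cabs_eq0 z : (cabs z == 0) = (z == 0).
Proof. by apply/eqP/eqP => [/ComplexField.Normc.eq0_normc|->] //; exact: cabs0. Qed.

Lemma cabs_gt0 z : (0 < cabs z) = (z != 0).
Proof. by rewrite lt_neqAle cabs_ge0 andbT eq_sym cabs_eq0. Qed.

Lemma cabsM z w : cabs (z * w) = cabs z * cabs w.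
Proof. exact: ComplexField.Normc.normcM. Qed.

Lemma cabsV z : cabs z^-1 = (cabs z)^-1.
Proof. exact: ComplexField.Normc.normcV. Qed.

Lemma cabsX z k : cabs (z ^+ k) = cabs z ^+ k.
Proof. by elim: k => [|k IH]; rewrite ?expr0 ?cabs1 // !exprS cabsM IH. Qed.

Lemma cabsN z : cabs (- z) = cabs z.
Proof. exact: normcN. Qed.

Lemma ler_cabsD z w : cabs (z + w) <= cabs z + cabs w.
Proof. exact: le_normcD. Qed.

Lemma ler_cabs_sum (I : finType) (F : I -> R[i]) :
  cabs (\sum_i F i) <= \sum_i cabs (F i).
Proof.
elim/big_rec2: _ => [|i y x _ le_xy]; first by rewrite cabs0.
by apply: le_trans (ler_cabsD _ _) _; rewrite lerD2l.
Qed.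

Lemma cabs_conj z : cabs (conjc z) = cabs z.
Proof. by case: z => a b; rewrite !cabsE /= sqrrN. Qed.

Lemma mul_conj z : z * conjc z = real_complex R (cabs z ^+ 2).
Proof.
case: z => a b; rewrite sqr_cabs /=; apply/eqP; rewrite eq_complex /=.
by apply/andP; split; apply/eqP; ring.
Qed.

Lemma cabs_real (a : R) : cabs (real_complex R a) = `|a|.
Proof. by rewrite cabsE /= expr0n addr0 sqrtr_sqr. Qed.

(** Lagrange's identity: twice the gap between the two sides is a sum of squares over all pairs of
    indices. *)
Lemma cauchy_schwarz_sum (I : finType) (a b : I -> R) :
  (\sum_i a i * b i) ^+ 2 <= (\sum_i a i ^+ 2) * (\sum_i b i ^+ 2).
Proof.
suff /eqP lagrange : ((\sum_i a i ^+ 2) * (\sum_i b i ^+ 2)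
   - (\sum_i a i * b i) ^+ 2) *+ 2 == \sum_i \sum_j (a i * b j - a j * b i) ^+ 2.
  rewrite -subr_ge0 -(@pmulrn_lge0 _ _ 2) // lagrange.
  by do 2 (apply: sumr_ge0 => ? _); exact: sqr_ge0.
have dbl (f g : I -> R) : (\sum_i f i) * (\sum_j g j) = \sum_i \sum_j f i * g j.
  by rewrite mulr_suml; apply: eq_bigr => i _; rewrite mulr_sumr.
have -> : \sum_i \sum_j (a i * b j - a j * b i) ^+ 2 =
    \sum_i \sum_j a i ^+ 2 * b j ^+ 2 + \sum_i \sum_j b i ^+ 2 * a j ^+ 2
    - (\sum_i \sum_j a i * b i * (a j * b j)) *+ 2.
  rewrite -sumrMnl -big_split -sumrB; apply: eq_bigr => i _.
  by rewrite -sumrMnl -big_split -sumrB; apply: eq_bigr => j _ /=; ring.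
by rewrite -!dbl; apply/eqP; ring.
Qed.

Lemma sum_sqr_ge0 (I : finType) (a : I -> R) : 0 <= \sum_i a i ^+ 2.
Proof. by apply: sumr_ge0 => i _; exact: sqr_ge0. Qed.

Lemma ler_sum_mul (I : finType) (a b : I -> R) :
  \sum_i a i * b i <= Num.sqrt (\sum_i a i ^+ 2) * Num.sqrt (\sum_i b i ^+ 2).
Proof.
rewrite -sqrtrM ?sum_sqr_ge0 //; apply: le_trans (ler_norm _) _.
by rewrite -sqrtr_sqr ler_wsqrtr // cauchy_schwarz_sum.
Qed.

Section Fro.
Variables m n : nat.
Implicit Types (M N : 'M[R[i]]_(m, n)).

Lemma fronorm_ge0 M : 0 <= fronorm M.
Proof. exact: sqrtr_ge0. Qed.

Lemma sqr_fronorm M : fronorm M ^+ 2 = \sum_i \sum_j cabs (M i j) ^+ 2.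
Proof. by rewrite sqr_sqrtr //; apply: sumr_ge0 => i _; exact: sum_sqr_ge0. Qed.

Lemma sqr_fronorm_pair M :
  fronorm M ^+ 2 = \sum_(k : 'I_m * 'I_n) cabs (M k.1 k.2) ^+ 2.
Proof. by rewrite sqr_fronorm pair_bigA. Qed.

Lemma fronorm_eq0 M : fronorm M = 0 -> M = 0.
Proof.
move=> M0; apply/matrixP => i j; rewrite mxE; apply/eqP.
have := sqr_fronorm_pair M; rewrite M0 expr0n /= => /esym /eqP.
rewrite psumr_eq0 => [/allP/(_ (i, j))|k _]; last exact: sqr_ge0.
by rewrite mem_index_enum => /(_ isT) /=; rewrite sqrf_eq0 cabs_eq0.
Qed.

Lemma fronorm0 : fronorm (0 : 'M[R[i]]_(m, n)) = 0.
Proof.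
apply/eqP; rewrite -sqrf_eq0 sqr_fronorm_pair big1 // => k _.
by rewrite mxE cabs0 expr0n.
Qed.

Lemma fronormN M : fronorm (- M) = fronorm M.
Proof. by congr Num.sqrt; do 2 apply: eq_bigr => ? _; rewrite mxE cabsN. Qed.

Lemma fronormZ z M : fronorm (z *: M) = cabs z * fronorm M.
Proof.
apply/eqP; rewrite -(@eqrXn2 _ 2) ?mulr_ge0 ?fronorm_ge0 ?cabs_ge0 //.
rewrite exprMn !sqr_fronorm_pair mulr_sumr; apply/eqP/eq_bigr => k _.
by rewrite mxE cabsM exprMn.
Qed.

Lemma ler_fronormD M N : fronorm (M + N) <= fronorm M + fronorm N.
Proof.
rewrite -(@ler_pXn2r _ 2) ?nnegrE ?addr_ge0 ?fronorm_ge0 //.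
rewrite sqrrD !sqr_fronorm_pair.
have cs := ler_sum_mul (fun k : 'I_m * 'I_n => cabs (M k.1 k.2))
                       (fun k => cabs (N k.1 k.2)).
rewrite -!sqr_fronorm_pair !sqrtr_sqr !ger0_norm ?fronorm_ge0 // in cs.
have cs2 := lerMn2r 2 (\sum_(k : 'I_m * 'I_n) cabs (M k.1 k.2) * cabs (N k.1 k.2))
  (fronorm M * fronorm N).
apply: (@le_trans _ _ (\sum_(k : 'I_m * 'I_n) cabs (M k.1 k.2) ^+ 2 +
  (\sum_(k : 'I_m * 'I_n) cabs (M k.1 k.2) * cabs (N k.1 k.2)) *+ 2 +
  \sum_(k : 'I_m * 'I_n) cabs (N k.1 k.2) ^+ 2)); last first.
  by rewrite lerD2r lerD2l cs2 cs.
rewrite -sumrMnl -!big_split /=; apply: ler_sum => k _.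
by rewrite mxE -sqrrD ler_pXn2r ?nnegrE ?addr_ge0 ?cabs_ge0 // ler_cabsD.
Qed.

End Fro.

Lemma ler_fronormM m n k (M : 'M[R[i]]_(m, n)) (N : 'M[R[i]]_(n, k)) :
  fronorm (M *m N) <= fronorm M * fronorm N.
Proof.
rewrite -(@ler_pXn2r _ 2) ?nnegrE ?mulr_ge0 ?fronorm_ge0 // exprMn !sqr_fronorm.
rewrite mulr_suml; apply: ler_sum => i _.
rewrite [X in _ <= _ * X]exchange_big mulr_sumr /=.
apply: ler_sum => j _; rewrite mxE.
apply: le_trans (cauchy_schwarz_sum _ _).
rewrite ler_pXn2r ?nnegrE ?cabs_ge0 //; last first.
  by apply: sumr_ge0 => l _; rewrite mulr_ge0 ?cabs_ge0.
by apply: le_trans (ler_cabs_sum _) _; apply: ler_sum => l _; rewrite cabsM.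
Qed.

Section Spec.
Variables m n : nat.
Implicit Types (M N : 'M[R[i]]_(m, n)) (v : 'cV[R[i]]_n).

Lemma specnorm_set_nonempty M :
  [set fronorm (M *m v) | v in [set v : 'cV[R[i]]_n | fronorm v <= 1]] !=set0.
Proof. by exists (fronorm (M *m (0 : 'cV[R[i]]_n))); exists 0 => //=; rewrite fronorm0 ler01. Qed.

Lemma specnorm_le M c : (forall v, fronorm v <= 1 -> fronorm (M *m v) <= c) ->
  specnorm M <= c.
Proof.
move=> le_c; apply: ge_sup; first exact: specnorm_set_nonempty.
by move=> _ [v v1 <-]; exact: le_c.
Qed.

Lemma specnorm_ub M v : fronorm v <= 1 -> fronorm (M *m v) <= specnorm M.
Proof.
move=> v1; apply: ub_le_sup; last by exists v.
exists (fronorm M) => _ [w w1 <-]; apply: le_trans (ler_fronormM _ _) _.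
by rewrite ler_piMr ?fronorm_ge0.
Qed.

Lemma specnorm_ge0 M : 0 <= specnorm M.
Proof.
apply: le_trans (fronorm_ge0 (M *m (0 : 'cV[R[i]]_n))) _; apply: specnorm_ub.
by rewrite fronorm0 ler01.
Qed.

Lemma specnorm_le_fronorm M : specnorm M <= fronorm M.
Proof.
apply: specnorm_le => v v1; apply: le_trans (ler_fronormM _ _) _.
by rewrite ler_piMr ?fronorm_ge0.
Qed.

Lemma ler_specnorm_mulv M v : fronorm (M *m v) <= specnorm M * fronorm v.
Proof.
have [/fronorm_eq0 ->|v0] := eqVneq (fronorm v) 0.
  by rewrite mulmx0 !fronorm0 mulr0.
have vp : 0 < fronorm v by rewrite lt_neqAle eq_sym v0 fronorm_ge0.
have := @specnorm_ub M (real_complex R (fronorm v)^-1 *: v).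
rewrite -scalemxAr !fronormZ cabs_real ger0_norm ?invr_ge0 ?fronorm_ge0 //.
by rewrite mulVf // => /(_ (lexx _)); rewrite mulrC ler_pdivrMr.
Qed.

End Spec.

Lemma specnorm_le_homo m n (M : 'M[R[i]]_(m, n)) (c : R) : 0 <= c ->
  (forall v : 'cV_n, fronorm (M *m v) <= c * fronorm v) -> specnorm M <= c.
Proof.
move=> c0 le_c; apply: specnorm_le => v v1; apply: le_trans (le_c v) _.
by rewrite ler_piMr.
Qed.

Definition adjmx m n (M : 'M[R[i]]_(m, n)) : 'M[R[i]]_(n, m) := map_mx conjc M^T.

Lemma adjmxM m n k (M : 'M[R[i]]_(m, n)) (N : 'M[R[i]]_(n, k)) :
  adjmx (M *m N) = adjmx N *m adjmx M.
Proof. by rewrite /adjmx trmx_mul map_mxM. Qed.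

Lemma adjmxK m n (M : 'M[R[i]]_(m, n)) : adjmx (adjmx M) = M.
Proof. by apply/matrixP => i j; rewrite !mxE conjcK. Qed.

Lemma fronorm_adj m n (M : 'M[R[i]]_(m, n)) : fronorm (adjmx M) = fronorm M.
Proof.
congr Num.sqrt; rewrite exchange_big; do 2 apply: eq_bigr => ? _.
by rewrite !mxE cabs_conj.
Qed.

Lemma adj_mulmx n (v : 'cV[R[i]]_n) :
  (adjmx v *m v) 0 0 = real_complex R (fronorm v ^+ 2).
Proof.
rewrite sqr_fronorm mxE raddf_sum; apply: eq_bigr => i _.
by rewrite big_ord1 !mxE mulrC mul_conj.
Qed.

Lemma cabs_adj_mulmx n (u v : 'cV[R[i]]_n) :
  cabs ((adjmx u *m v) 0 0) <= fronorm u * fronorm v.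
Proof.
rewrite -(fronorm_adj u); apply: le_trans (ler_fronormM _ _).
by rewrite /fronorm !big_ord1 sqrtr_sqr ger0_norm ?cabs_ge0.
Qed.

(** With [w = M^* v], one has [|w|^2 = v^* M w <= |v| |M| |w|], and a nonzero [|w|] cancels. *)
Lemma specnorm_adj m n (M : 'M[R[i]]_(m, n)) : specnorm (adjmx M) <= specnorm M.
Proof.
apply: specnorm_le_homo => [|v]; first exact: specnorm_ge0.
set w := adjmx M *m v.
have [->|w0] := eqVneq (fronorm w) 0; first by rewrite mulr_ge0 ?specnorm_ge0 ?fronorm_ge0.
have wp : 0 < fronorm w by rewrite lt_neqAle eq_sym w0 fronorm_ge0.
rewrite -(ler_pM2r wp) -expr2 -[_ ^+ 2]ger0_norm ?sqr_ge0 //.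
rewrite -cabs_real -adj_mulmx {1}/w adjmxM adjmxK -mulmxA.
apply: le_trans (cabs_adj_mulmx _ _) _.
by rewrite mulrAC mulrC ler_wpM2r ?fronorm_ge0 // ler_specnorm_mulv.
Qed.

(** Working column by column controls a product by the spectral norm of its left factor; adjoints
    exchange the factors. This form is needed because the factor [invmx (1 + D)] stands to the right
    of the responses. *)
Lemma ler_fronorm_mul_spec m n k (M : 'M[R[i]]_(m, n)) (N : 'M[R[i]]_(n, k)) :
  fronorm (M *m N) <= fronorm M * specnorm N.
Proof.
rewrite -fronorm_adj -(fronorm_adj M) adjmxM.
set P := adjmx M; rewrite -(@ler_pXn2r _ 2) ?nnegrE ?mulr_ge0 ?fronorm_ge0 ?specnorm_ge0 //.
have colF a b (X : 'M[R[i]]_(a, b)) : fronorm X ^+ 2 = \sum_j fronorm (col j X) ^+ 2.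
  rewrite sqr_fronorm exchange_big; apply: eq_bigr => j _.
  by rewrite sqr_fronorm; apply: eq_bigr => i _; rewrite big_ord1 mxE.
rewrite exprMn !colF mulr_suml; apply: ler_sum => j _.
rewrite -exprMn ler_pXn2r ?nnegrE ?mulr_ge0 ?fronorm_ge0 ?specnorm_ge0 //.
rewrite colE -mulmxA -colE mulrC.
by apply: le_trans (ler_specnorm_mulv _ _) _; rewrite ler_wpM2r ?fronorm_ge0 // specnorm_adj.
Qed.

Lemma fronorm_col_mx m1 m2 n (M : 'M[R[i]]_(m1, n)) (N : 'M[R[i]]_(m2, n)) :
  fronorm (col_mx M N) ^+ 2 = fronorm M ^+ 2 + fronorm N ^+ 2.
Proof.
rewrite !sqr_fronorm big_split_ord /=; congr (_ + _).
  by do 2 apply: eq_bigr => ? _; rewrite col_mxEu.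
by do 2 apply: eq_bigr => ? _; rewrite col_mxEd.
Qed.

End EuclideanNorms.

(** * Values of rational functions at finite points and at infinity *)

Section RationalFunctions.
Variable R : realType.
Local Notation tofrac := (@FracField.tofrac {poly R}).
Local Notation cpoly := (map_poly (real_complex R)).
Implicit Types (f g : ratfun R) (p q : {poly R}) (z : R[i]).

Lemma tofrac_repr f :
  f = tofrac (frac (repr f)).1 / tofrac (frac (repr f)).2.
Proof.
have d0 := denom_ratioP (repr f).
apply: (canRL (mulfK _)); first by rewrite tofrac_eq0.
rewrite -{1}[f]reprK; unlock FracField.tofrac.
rewrite -[LHS]FracField.pi_mul; apply/eqmodP => /=.
by rewrite FracField.equivfE /FracField.mulf !numden_Ratio ?mulf_neq0 ?oner_eq0 // !mulr1 mulrC.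
Qed.

Lemma gcdp_repr_neq0 f : gcdp (frac (repr f)).1 (frac (repr f)).2 != 0.
Proof. by rewrite gcdp_eq0 negb_and (denom_ratioP (repr f)) orbT. Qed.

Lemma ratnumK f :
  ratnum f * gcdp (frac (repr f)).1 (frac (repr f)).2 = (frac (repr f)).1.
Proof. by rewrite divpK ?dvdp_gcdl. Qed.

Lemma ratdenK f :
  ratden f * gcdp (frac (repr f)).1 (frac (repr f)).2 = (frac (repr f)).2.
Proof. by rewrite divpK ?dvdp_gcdr. Qed.

Lemma ratden_neq0 f : ratden f != 0.
Proof.
by apply: contraNneq (denom_ratioP (repr f)) => d0; rewrite -ratdenK d0 mul0r.
Qed.

Lemma ratfun_numden f : f = tofrac (ratnum f) / tofrac (ratden f).
Proof.
rewrite {1}[f]tofrac_repr -[X in tofrac X / _ = _]ratnumK.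
rewrite -[X in _ / tofrac X = _]ratdenK !tofracM -mulf_div divff ?mulr1 //.
by rewrite tofrac_eq0 gcdp_repr_neq0.
Qed.

Lemma coprimep_ratnumden f : coprimep (ratnum f) (ratden f).
Proof.
have := coprimep_div_gcd (p := (frac (repr f)).1) (q := (frac (repr f)).2).
by apply; rewrite (denom_ratioP (repr f)) orbT.
Qed.

Lemma tofrac_div_eq p q r s : q != 0 -> s != 0 ->
  (tofrac p / tofrac q == tofrac r / tofrac s) = (p * s == q * r).
Proof.
by move=> q0 s0; rewrite eqr_div ?tofrac_eq0 // -!tofracM tofrac_eq [r * q]mulrC.
Qed.

(** The reduced fraction is fixed only up to a scalar, so it is compared with any other fraction for
    [f] through this cross-multiplied identity. *)
Lemma ratnumden_cross f p q : q != 0 -> f = tofrac p / tofrac q ->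
  p * ratden f = q * ratnum f.
Proof.
move=> q0 fE; apply/eqP; rewrite -tofrac_div_eq ?ratden_neq0 //.
by rewrite -fE -ratfun_numden.
Qed.

Lemma ratden_dvd f p q : q != 0 -> f = tofrac p / tofrac q -> ratden f %| q.
Proof.
move=> q0 /(ratnumden_cross q0) E.
by rewrite -(@Gauss_dvdpl _ q (ratnum f) (ratden f)) 1?coprimep_sym ?coprimep_ratnumden //
  -E dvdp_mull.
Qed.

Definition regular_at z f := (cpoly (ratden f)).[z] != 0.

Lemma regular_atP z f : regular_at z f <-> ~ ratpole f z.
Proof. by rewrite /regular_at /ratpole /root; split=> [/negP|/negP]. Qed.

(** Since [ratden f] divides every denominator of [f], a fraction that is not in lowest terms may be
    used for evaluation wherever its denominator does not vanish. The field operations are evaluated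
    this way. *)
Lemma regular_evalP z f p q : (cpoly q).[z] != 0 -> f = tofrac p / tofrac q ->
  regular_at z f /\ rateval f z = (cpoly p).[z] / (cpoly q).[z].
Proof.
move=> qz fE; have q0 : q != 0 by apply: contraNneq qz => ->; rewrite rmorph0 horner0.
have dz : regular_at z f.
  have /dvdpP[r qE] := ratden_dvd q0 fE.
  by apply: contraNneq qz => dz; rewrite qE rmorphM hornerM dz mulr0.
split=> //; apply/eqP; rewrite eqr_div //.
have /(congr1 (fun s => (cpoly s).[z])) := ratnumden_cross q0 fE.
by rewrite /= !rmorphM !hornerM => ->; rewrite mulrC.
Qed.

Lemma regularB z f g : regular_at z f -> regular_at z g ->
  regular_at z (f - g) /\ rateval (f - g) z = rateval f z - rateval g z.
Proof.
move=> fz gz; have [f0 g0] := (ratden_neq0 f, ratden_neq0 g).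
have [] := @regular_evalP z (f - g) (ratnum f * ratden g - ratnum g * ratden f)
  (ratden f * ratden g).
- by rewrite rmorphM hornerM mulf_neq0.
- rewrite {1}[f]ratfun_numden {1}[g]ratfun_numden -[- (_ / _)]mulNr addf_div ?tofrac_eq0 //.
  by rewrite !(tofracM, tofracB) mulNr.
move=> ? ->; split => //; rewrite /rateval -[- (_ / _)]mulNr addf_div //.
by rewrite !(rmorphM, rmorphB) /= !(hornerM, hornerD, hornerN) mulNr.
Qed.

Lemma regularM z f g : regular_at z f -> regular_at z g ->
  regular_at z (f * g) /\ rateval (f * g) z = rateval f z * rateval g z.
Proof.
move=> fz gz; have [f0 g0] := (ratden_neq0 f, ratden_neq0 g).
have [] := @regular_evalP z (f * g) (ratnum f * ratnum g) (ratden f * ratden g).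
- by rewrite rmorphM hornerM mulf_neq0.
- by rewrite {1}[f]ratfun_numden {1}[g]ratfun_numden mulf_div !tofracM.
by move=> ? ->; split => //; rewrite /rateval mulf_div !rmorphM !hornerM.
Qed.

Lemma regularV z f : regular_at z f -> rateval f z != 0 ->
  regular_at z f^-1.
Proof.
move=> fz; rewrite mulf_eq0 negb_or => /andP[nz _].
have [] // := @regular_evalP z f^-1 (ratden f) (ratnum f) nz.
by rewrite {1}[f]ratfun_numden invf_div.
Qed.

Lemma regularC z (a : R) :
  regular_at z (ratC a) /\ rateval (ratC a) z = real_complex R a.
Proof.
have [] := @regular_evalP z (ratC a) a%:P 1.
- by rewrite rmorph1 hornerC oner_eq0.
- by rewrite tofrac1 divr1.
by move=> ? ->; rewrite rmorph1 map_polyC !hornerC divr1.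
Qed.

(** The degrees [m] and [n] are nominal: a numerator is read at the degree of its denominator, where
    its coefficient may be 0. *)
Lemma coef_top_mul p q m n : (size p <= m.+1)%N -> (size q <= n.+1)%N ->
  (p * q)`_(m + n) = p`_m * q`_n.
Proof.
move=> sp sq; rewrite coefM (bigD1 (inord m)) //= inordK ?ltnS ?leq_addr //.
rewrite addKn big1 ?addr0 // => i; rewrite -val_eqE /= inordK ?ltnS ?leq_addr // => im.
case: (ltngtP i m) im => // im _.
  by rewrite [q`__]nth_default ?mulr0 // (leq_trans sq) // ltn_subRL ltn_add2r.
by rewrite nth_default ?mul0r // (leq_trans sp).
Qed.

(** The point at infinity: [regular_oo] is properness of one entry and [value_oo] its limit there,
    meaningful only under [regular_oo]. The index [(size (ratden f)).-1] is the degree of the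
    denominator, so the value is 0 exactly when a proper [f] is strictly proper. *)
Definition regular_oo f := (size (ratnum f) <= size (ratden f))%N.
Definition value_oo f := (ratnum f)`_(size (ratden f)).-1 / lead_coef (ratden f).

(** The relative degree does not depend on the fraction. It is written additively to avoid truncated
    subtraction, and the zero numerator is set apart because [size 0 = 0] breaks the degree formula
    for products. *)
Lemma size_ratnumden f p q : q != 0 -> f = tofrac p / tofrac q ->
  (size p + size (ratden f) = size q + size (ratnum f))%N \/ p = 0 /\ ratnum f = 0.
Proof.
move=> q0 fE; have E := ratnumden_cross q0 fE; have d0 := ratden_neq0 f.
have [p0|p0] := eqVneq p 0.
  right; split=> //; move/eqP: E; rewrite p0 mul0r eq_sym mulf_eq0 (negPf q0).
  by move/eqP.
have n0 : ratnum f != 0.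
  by apply: contra_neq p0 => n0; move/eqP: E; rewrite n0 mulr0 mulf_eq0 (negPf d0) orbF => /eqP.
left; have := congr1 (fun s : {poly R} => size s) E; rewrite /= !size_mul //.
move: p0 q0 n0 d0; rewrite -!size_poly_gt0.
by case: (size p) => // a; case: (size q) => // b; rewrite !addSn /= => _ _ _ _ ->.
Qed.

Lemma regular_ooE f p q : q != 0 -> f = tofrac p / tofrac q ->
  regular_oo f = (size p <= size q)%N.
Proof.
rewrite /regular_oo => q0 /(size_ratnumden q0) [E|[-> ->]]; last by rewrite size_poly0.
by rewrite -(leq_add2l (size q)) -E leq_add2r.
Qed.

Lemma value_ooE f p q : q != 0 -> f = tofrac p / tofrac q ->
  (size p <= size q)%N -> value_oo f = p`_(size q).-1 / lead_coef q.
Proof.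
move=> q0 fE pq; have fo : regular_oo f by rewrite (regular_ooE q0 fE).
apply/eqP; rewrite eqr_div ?lead_coef_eq0 ?ratden_neq0 //; apply/eqP.
have d0 := ratden_neq0 f.
have sz (s : {poly R}) : s != 0 -> (size s).-1.+1 = size s.
  by rewrite -size_poly_gt0 => /prednK.
rewrite mulrC -!coef_top_mul ?sz //.
by rewrite mulrC; congr (_`_ _); rewrite ?(ratnumden_cross q0 fE) 1?mulrC // addnC.
Qed.

Lemma strictly_properE f : (size (ratnum f) < size (ratden f))%N =
  regular_oo f && (value_oo f == 0).
Proof.
rewrite /regular_oo ltn_neqAle andbC; case: leqP => //= le_nd.
rewrite /value_oo mulf_eq0 invr_eq0 lead_coef_eq0 (negPf (ratden_neq0 f)) orbF.
have [E|ne] /= := eqVneq (size (ratnum f)) (size (ratden f)).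
  by rewrite -E -lead_coefE lead_coef_eq0 -size_poly_eq0 E size_poly_eq0 (negPf (ratden_neq0 f)).
rewrite nth_default ?eqxx // -ltnS prednK ?size_poly_gt0 ?ratden_neq0 //.
by rewrite ltn_neqAle ne.
Qed.

Lemma regular_oo_frac p q : q != 0 -> (size p <= size q)%N ->
  regular_oo (tofrac p / tofrac q) /\
  value_oo (tofrac p / tofrac q) = p`_(size q).-1 / lead_coef q.
Proof. by move=> q0 pq; rewrite (regular_ooE q0 (erefl _)) (value_ooE q0 (erefl _)). Qed.

Lemma regular_ooB f g : regular_oo f -> regular_oo g ->
  regular_oo (f - g) /\ value_oo (f - g) = value_oo f - value_oo g.
Proof.
move=> fz gz; rewrite /regular_oo in fz gz.
have [f0 g0] := (ratden_neq0 f, ratden_neq0 g).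
have -> : f - g = tofrac (ratnum f * ratden g - ratnum g * ratden f) /
  tofrac (ratden f * ratden g).
  rewrite {1}[f]ratfun_numden {1}[g]ratfun_numden -[- (_ / _)]mulNr addf_div ?tofrac_eq0 //.
  by rewrite !(tofracM, tofracB) mulNr.
have fg0 : ratden f * ratden g != 0 by rewrite mulf_neq0.
have szd : size (ratden f * ratden g) = ((size (ratden f)).-1 + (size (ratden g)).-1).+1.
  move: (f0) (g0); rewrite size_mul // -!size_poly_gt0.
  by case: (size _) => // ?; case: (size _) => // ?; rewrite addnS.
have sz (s : ratfun R) : (size (ratden s)).-1.+1 = size (ratden s).
  by rewrite prednK // size_poly_gt0 ratden_neq0.
have szm (p q : {poly R}) m n : (size p <= m.+1)%N -> (size q <= n.+1)%N ->
    (size (p * q)%R <= (m + n).+1)%N.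
  move=> sp sq; apply: leq_trans (size_polyMleq _ _) _.
  by case: (size p + size q)%N (leq_add sp sq) => // k; rewrite addSn addnS ltnS.
have [|-> ->] := regular_oo_frac (p := ratnum f * ratden g - ratnum g * ratden f) fg0.
  rewrite szd; apply: leq_trans (size_polyD _ _) _; rewrite geq_max size_polyN.
  apply/andP; split; first by apply: szm; rewrite sz ?(fz, leqnn).
  by rewrite [X in (_ <= X.+1)%N]addnC; apply: szm; rewrite sz ?(gz, leqnn).
split=> //; rewrite szd /= coefB coef_top_mul ?sz //.
rewrite addnC coef_top_mul ?sz // lead_coefM /value_oo -[- (_ / _)]mulNr addf_div ?lead_coef_eq0 //.
by rewrite mulNr !lead_coefE.
Qed.

Lemma regular_ooM f g : regular_oo f -> regular_oo g ->
  regular_oo (f * g) /\ value_oo (f * g) = value_oo f * value_oo g.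
Proof.
move=> fz gz; have [f0 g0] := (ratden_neq0 f, ratden_neq0 g).
have -> : f * g = tofrac (ratnum f * ratnum g) / tofrac (ratden f * ratden g).
  by rewrite {1}[f]ratfun_numden {1}[g]ratfun_numden mulf_div !tofracM.
have fg0 : ratden f * ratden g != 0 by rewrite mulf_neq0.
have szd : size (ratden f * ratden g) = ((size (ratden f)).-1 + (size (ratden g)).-1).+1.
  move: (f0) (g0); rewrite size_mul // -!size_poly_gt0.
  by case: (size _) => // ?; case: (size _) => // ?; rewrite addnS.
have sz (s : ratfun R) : (size (ratden s)).-1.+1 = size (ratden s).
  by rewrite prednK // size_poly_gt0 ratden_neq0.
have [|-> ->] := regular_oo_frac (p := ratnum f * ratnum g) fg0.
  rewrite szd; apply: leq_trans (size_polyMleq _ _) _.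
  have := leq_add fz gz; rewrite -(sz f) -(sz g) addSn addnS.
  by case: (size (ratnum f) + size (ratnum g))%N.
by split=> //; rewrite szd /= coef_top_mul ?sz // lead_coefM /value_oo mulf_div.
Qed.

Lemma regular_ooV f : regular_oo f -> value_oo f != 0 -> regular_oo f^-1.
Proof.
rewrite {1}/regular_oo => le_nd fo.
have E : size (ratnum f) = size (ratden f).
  apply: contraNeq fo => ne; have : (size (ratnum f) < size (ratden f))%N.
    by rewrite ltn_neqAle ne.
  by rewrite strictly_properE => /andP[].
have n0 : ratnum f != 0 by rewrite -size_poly_gt0 E size_poly_gt0 ratden_neq0.
rewrite {1}[f]ratfun_numden invf_div (regular_ooE n0 (erefl _)).
by rewrite E.
Qed.

Lemma regular_ooC (a : R) : regular_oo (ratC a) /\ value_oo (ratC a) = a.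
Proof.
have -> : ratC a = tofrac a%:P / tofrac 1 by rewrite tofrac1 divr1.
have [||-> ->] := @regular_oo_frac a%:P 1; rewrite ?oner_eq0 ?size_poly1 //.
  exact: size_polyC_leq1.
by rewrite coefC lead_coef1 divr1.
Qed.

End RationalFunctions.

(** * Matrices with entries regular at a place *)

Section Places.
Variables (F K : fieldType).

(* A valuation ring [O] of [F] with its residue map [e], of which only the
   values on [O] matter. *)
Definition place (O : F -> Prop) (e : F -> K) : Prop :=
  [/\ O 1 /\ e 1 = 1,
      forall f g, O f -> O g -> O (f - g) /\ e (f - g) = e f - e g,
      forall f g, O f -> O g -> O (f * g) /\ e (f * g) = e f * e g &
      forall f, O f -> e f != 0 -> O f^-1].

Variables (O : F -> Prop) (e : F -> K).
Hypothesis Oe : place O e.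

Lemma place1 : O 1 /\ e 1 = 1. Proof. by case: Oe. Qed.

Lemma place0 : O 0 /\ e 0 = 0.
Proof.
have [ [onO e1] eB _ _] := Oe.
by have [] := eB _ _ onO onO; rewrite !subrr.
Qed.

Lemma placeN f : O f -> O (- f) /\ e (- f) = - e f.
Proof.
have [ [zeO e0] [_ eB _ _]] := (place0, Oe) => Of.
by have [] := eB _ _ zeO Of; rewrite e0 !sub0r.
Qed.

Lemma placeD f g : O f -> O g -> O (f + g) /\ e (f + g) = e f + e g.
Proof.
have [_ eB _ _] := Oe => Of /placeN[Og eg].
by have [] := eB _ _ Of Og; rewrite eg !opprK.
Qed.

Lemma placeM f g : O f -> O g -> O (f * g) /\ e (f * g) = e f * e g.
Proof. by have [_ _ eM _] := Oe; exact: eM. Qed.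

Lemma place_sum (I : finType) (f : I -> F) : (forall i, O (f i)) ->
  O (\sum_i f i) /\ e (\sum_i f i) = \sum_i e (f i).
Proof.
move=> Of; elim/big_rec2: _ => [|i y x _ [Ox <-]]; first exact: place0.
exact: placeD.
Qed.

Lemma place_prod (I : finType) (f : I -> F) : (forall i, O (f i)) ->
  O (\prod_i f i) /\ e (\prod_i f i) = \prod_i e (f i).
Proof.
move=> Of; elim/big_rec2: _ => [|i y x _ [Ox <-]]; first exact: place1.
exact: placeM.
Qed.

Lemma place_sign k : O ((-1) ^+ k) /\ e ((-1) ^+ k) = (-1) ^+ k.
Proof.
have [onO e1] := place1; have [ON eN] := placeN onO.
elim: k => [|k [Ok ek]]; first by rewrite !expr0.
by rewrite !exprS; have [? ->] := placeM ON Ok; rewrite ek eN e1.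
Qed.

Definition regular_mx m n (G : 'M[F]_(m, n)) : Prop := forall i j, O (G i j).

Lemma place_det n (G : 'M[F]_n) : regular_mx G ->
  O (\det G) /\ e (\det G) = \det (map_mx e G).
Proof.
move=> OG; have Os (s : 'S_n) : O ((-1) ^+ s * \prod_i G i (s i)) /\
    e ((-1) ^+ s * \prod_i G i (s i)) = (-1) ^+ s * \prod_i (map_mx e G) i (s i).
  have [? <-] := place_sign s.
  have [? E] := @place_prod _ (fun i => G i (s i)) (fun i => OG _ _).
  under [in RHS]eq_bigr do rewrite mxE.
  by rewrite -E; exact: placeM.
have [? ->] := @place_sum _ (fun s : 'S_n => (-1) ^+ s * \prod_i G i (s i))
  (fun s => (Os s).1).
by split=> //; apply: eq_bigr => s _; rewrite (Os s).2.
Qed.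

Lemma place_mulmx m n k (G : 'M[F]_(m, n)) (H : 'M[F]_(n, k)) :
  regular_mx G -> regular_mx H ->
  regular_mx (G *m H) /\ map_mx e (G *m H) = map_mx e G *m map_mx e H.
Proof.
move=> OG OH; have Os i j := place_sum (fun l => (placeM (OG i l) (OH l j)).1).
split=> [i j|]; first by rewrite mxE; have [] := Os i j.
apply/matrixP => i j; rewrite !mxE (Os i j).2; apply: eq_bigr => l _.
by rewrite !mxE (placeM _ _).2.
Qed.

Lemma place_addmx m n (G H : 'M[F]_(m, n)) : regular_mx G -> regular_mx H ->
  regular_mx (G + H) /\ map_mx e (G + H) = map_mx e G + map_mx e H.
Proof.
move=> OG OH; split=> [i j|]; first by rewrite mxE; have [] := placeD (OG i j) (OH i j).
by apply/matrixP => i j; rewrite !mxE (placeD _ _).2.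
Qed.

Lemma place_scalemx m n c (G : 'M[F]_(m, n)) : O c -> regular_mx G ->
  regular_mx (c *: G) /\ map_mx e (c *: G) = e c *: map_mx e G.
Proof.
move=> Oc OG; split=> [i j|]; first by rewrite mxE; have [] := placeM Oc (OG i j).
by apply/matrixP => i j; rewrite !mxE (placeM _ _).2.
Qed.

Lemma place_1mx n : regular_mx (1%:M : 'M[F]_n) /\ map_mx e (1%:M : 'M[F]_n) = 1%:M.
Proof.
have [ [onO e1] [zeO e0]] := (place1, place0).
by split=> [i j|]; [|apply/matrixP => i j]; rewrite !mxE; case: (i == j).
Qed.

(** By the adjugate formula the entries of the inverse are signed minors over the determinant.
    Minors are regular, and the inverse of the determinant is regular because its value is
    nonzero. *)
Lemma place_invmx n (G : 'M[F]_n) : regular_mx G -> \det (map_mx e G) != 0 ->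
  G \in unitmx /\ regular_mx (invmx G).
Proof.
move=> OG d0; have [Od ed] := place_det OG.
have [_ _ _ eV] := Oe; rewrite -ed in d0; have OdV := eV _ Od d0.
have Gu : G \in unitmx.
  by rewrite unitmxE unitfE; apply: contraNneq d0 => ->; rewrite place0.2.
split=> // i j; rewrite /invmx Gu !mxE; apply: (placeM OdV _).1.
apply: (placeM (place_sign _).1 (place_det _).1).1 => k l.
by rewrite !mxE.
Qed.

End Places.

(** * Stable and proper transfer matrices *)

Section StableTransferMatrices.
Variable R : realType.
Local Notation cpoly := (map_poly (real_complex R)).

Lemma place_at (z : R[i]) : place (regular_at z) (fun f : ratfun R => rateval f z).
Proof.
split; [|exact: regularB|exact: regularM|exact: regularV].
have -> : 1 = ratC (1 : R) by rewrite /ratC polyC1 tofrac1.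
by have [? ->] := regularC z 1; rewrite rmorph1.
Qed.

Lemma place_oo : place (fun f : ratfun R => regular_oo f) (@value_oo R).
Proof.
split; [|exact: regular_ooB|exact: regular_ooM|exact: regular_ooV].
have -> : 1 = ratC (1 : R) by rewrite /ratC polyC1 tofrac1.
exact: regular_ooC.
Qed.

(** Finite points only; properness covers infinity. Together they present [RHoo] as an intersection
    of valuation rings, from which its closure under ring operations follows. *)
Definition stable m n (G : 'M[ratfun R]_(m, n)) : Prop :=
  forall z, 1 <= cabs z -> regular_mx (regular_at z) G.

Lemma strictly_properP m n (G : 'M[ratfun R]_(m, n)) :
  strictly_proper G <-> Defs.proper G /\ map_mx (@value_oo R) G = 0.
Proof.
split=> [sG|[pG G0]]; last first.
  move=> i j; have /matrixP/(_ i j) := G0; rewrite !mxE => vG;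
    rewrite strictly_properE vG eqxx andbT; exact: (pG i j).
split=> [i j|]; first by have := sG i j; rewrite strictly_properE => /andP[].
by apply/matrixP => i j; have := sG i j; rewrite strictly_properE !mxE => /andP[_ /eqP].
Qed.

Lemma RHooP m n (G : 'M[ratfun R]_(m, n)) : RHoo G <-> Defs.proper G /\ stable G.
Proof.
split=> -[pG sG]; (split; first exact: pG).
  move=> z z1 i j; apply/regular_atP => /sG; by rewrite ltNge z1.
move=> i j z pz; rewrite ltNge; apply/negP => z1.
by have /regular_atP := sG z z1 i j; apply.
Qed.

Lemma zinvRHooP m n (G : 'M[ratfun R]_(m, n)) :
  zinvRHoo G <-> strictly_proper G /\ stable G.
Proof.
split=> [ [/RHooP[_ sG] spG] //|[spG sG]]; split=> //; apply/RHooP; split=> //.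
by have /strictly_properP[] := spG.
Qed.

Lemma stable_mulmx m n k (G : 'M[ratfun R]_(m, n)) (H : 'M[ratfun R]_(n, k)) :
  stable G -> stable H -> stable (G *m H).
Proof. by move=> sG sH z z1; have [] := place_mulmx (place_at z) (sG z z1) (sH z z1). Qed.

Lemma evalmx_mul m n k (G : 'M[ratfun R]_(m, n)) (H : 'M[ratfun R]_(n, k)) z :
  stable G -> stable H -> 1 <= cabs z ->
  evalmx (G *m H) z = evalmx G z *m evalmx H z.
Proof. by move=> sG sH z1; have [] := place_mulmx (place_at z) (sG z z1) (sH z z1). Qed.

Lemma evalmx_add m n (G H : 'M[ratfun R]_(m, n)) z :
  stable G -> stable H -> 1 <= cabs z ->
  evalmx (G + H) z = evalmx G z + evalmx H z.
Proof. by move=> sG sH z1; have [] := place_addmx (place_at z) (sG z z1) (sH z z1). Qed.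

Lemma stable_add m n (G H : 'M[ratfun R]_(m, n)) :
  stable G -> stable H -> stable (G + H).
Proof. by move=> sG sH z z1; have [] := place_addmx (place_at z) (sG z z1) (sH z z1). Qed.

Lemma stable1 n : stable (1%:M : 'M[ratfun R]_n).
Proof. by move=> z z1; have [] := place_1mx (place_at z) n. Qed.

Lemma evalmx1 n z : evalmx (1%:M : 'M[ratfun R]_n) z = 1%:M.
Proof. by have [] := place_1mx (place_at z) n. Qed.

Lemma stable_const m n (M : 'M[R]_(m, n)) : stable (constmx M).
Proof. by move=> z z1 i j; rewrite mxE; have [] := regularC z (M i j). Qed.

Lemma evalmx_const m n (M : 'M[R]_(m, n)) z :
  evalmx (constmx M) z = map_mx (real_complex R) M.
Proof. by apply/matrixP => i j; rewrite !mxE; have [] := regularC z (M i j). Qed.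

Lemma proper_const m n (M : 'M[R]_(m, n)) : Defs.proper (constmx M).
Proof. by move=> i j; rewrite mxE; have [] := regular_ooC (M i j). Qed.

Lemma stable_scale m n (a : R) (G : 'M[ratfun R]_(m, n)) :
  stable G -> stable (ratC a *: G).
Proof.
move=> sG z z1; have [+ _] := regularC z a => aR.
by have [] := place_scalemx (place_at z) aR (sG z z1).
Qed.

Lemma evalmx_scale m n (a : R) (G : 'M[ratfun R]_(m, n)) z :
  stable G -> 1 <= cabs z ->
  evalmx (ratC a *: G) z = real_complex R a *: evalmx G z.
Proof.
move=> sG z1; have [aR aE] := regularC z a.
by rewrite -aE; have [] := place_scalemx (place_at z) aR (sG z z1).
Qed.

Lemma stable_col_mx m1 m2 n (G : 'M[ratfun R]_(m1, n)) (H : 'M[ratfun R]_(m2, n)) :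
  stable G -> stable H -> stable (col_mx G H).
Proof.
move=> sG sH z z1 i j; rewrite mxE; case: fintype.split => k; [exact: sG|exact: sH].
Qed.

Lemma evalmx_col_mx m1 m2 n (G : 'M[ratfun R]_(m1, n)) (H : 'M[ratfun R]_(m2, n)) z :
  evalmx (col_mx G H) z = col_mx (evalmx G z) (evalmx H z).
Proof. exact: map_col_mx. Qed.

Lemma strictly_proper_mulr m n k (G : 'M[ratfun R]_(m, n)) (H : 'M[ratfun R]_(n, k)) :
  strictly_proper G -> Defs.proper H -> strictly_proper (G *m H).
Proof.
move=> /strictly_properP[pG G0] pH; apply/strictly_properP.
by have [? ->] := place_mulmx place_oo pG pH; rewrite G0 mul0mx.
Qed.

Lemma strictly_proper_mull m n k (G : 'M[ratfun R]_(m, n)) (H : 'M[ratfun R]_(n, k)) :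
  Defs.proper G -> strictly_proper H -> strictly_proper (G *m H).
Proof.
move=> pG /strictly_properP[pH H0]; apply/strictly_properP.
by have [? ->] := place_mulmx place_oo pG pH; rewrite H0 mulmx0.
Qed.

Lemma strictly_proper_add m n (G H : 'M[ratfun R]_(m, n)) :
  strictly_proper G -> strictly_proper H -> strictly_proper (G + H).
Proof.
move=> /strictly_properP[pG G0] /strictly_properP[pH H0]; apply/strictly_properP.
by have [? ->] := place_addmx place_oo pG pH; rewrite H0 G0 addr0.
Qed.

Lemma invmx_1Dstrictly_proper n (M : 'M[ratfun R]_n) : strictly_proper M ->
  1%:M + M \in unitmx /\ Defs.proper (invmx (1%:M + M)).
Proof.
move=> /strictly_properP[pM M0]; have [p1 e1] := place_1mx place_oo n.
have [pD eD] := place_addmx place_oo p1 pM.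
by apply: (place_invmx place_oo) => //; rewrite eD e1 M0 addr0 det1 oner_neq0.
Qed.

Lemma zinvRHoo_mulr m n k (G : 'M[ratfun R]_(m, n)) (H : 'M[ratfun R]_(n, k)) :
  zinvRHoo G -> RHoo H -> zinvRHoo (G *m H).
Proof.
move=> /zinvRHooP[pG sG] /RHooP[pH sH]; apply/zinvRHooP.
by split; [exact: strictly_proper_mulr|exact: stable_mulmx].
Qed.

Lemma zinvRHoo_mull_const m n k (M : 'M[R]_(m, n)) (H : 'M[ratfun R]_(n, k)) :
  zinvRHoo H -> zinvRHoo (constmx M *m H).
Proof.
move=> /zinvRHooP[pH sH]; apply/zinvRHooP; split.
  by apply: strictly_proper_mull => //; exact: proper_const.
by apply: stable_mulmx => //; exact: stable_const.
Qed.

Lemma zinvRHoo_add m n (G H : 'M[ratfun R]_(m, n)) :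
  zinvRHoo G -> zinvRHoo H -> zinvRHoo (G + H).
Proof.
move=> /zinvRHooP[pG sG] /zinvRHooP[pH sH]; apply/zinvRHooP.
by split; [exact: strictly_proper_add|exact: stable_add].
Qed.

End StableTransferMatrices.

(** * Maximum modulus principle for quotients of polynomials *)

Section MaximumModulus.
Variable R : realType.
Local Notation Rez := (@complex.Re R).
Local Notation Imz := (@complex.Im R).
Implicit Types (P D : {poly R[i]}) (z : R[i]).

(** Continuity is expressed through real coordinates so that it serves three purposes: compactness
    of the disk in the plane, motion along a ray, and integration over the circle. *)
Lemma continuous_horner (T : topologicalType) (x y : T -> R) P :
  continuous x -> continuous y ->
  continuous (fun t => Rez P.[Complex (x t) (y t)]) /\
  continuous (fun t => Imz P.[Complex (x t) (y t)]).
Proof.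
move=> cx cy; elim/poly_ind: P => [|P c [cR cI]].
  by split; under eq_fun do rewrite horner0 /=; exact: cst_continuous.
pose re t := Rez P.[Complex (x t) (y t)]; pose im t := Imz P.[Complex (x t) (y t)].
have mulE (u v : R[i]) : Rez (u * v + c) = Rez u * Rez v - Imz u * Imz v + Rez c /\
    Imz (u * v + c) = Rez u * Imz v + Imz u * Rez v + Imz c.
  by case: u v c => [? ?] [? ?] [? ?].
split.
  rewrite (_ : (fun _ => _) = fun t => re t * x t - im t * y t + Rez c); last first.
    by apply/funext => t; rewrite hornerMXaddC (mulE _ _).1.
  move=> t; apply: cvgD; [apply: cvgB; apply: cvgM|exact: cvg_cst].
  - exact: cR.
  - exact: cx.
  - exact: cI.
  - exact: cy.
rewrite (_ : (fun _ => _) = fun t => re t * y t + im t * x t + Imz c); last first.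
  by apply/funext => t; rewrite hornerMXaddC (mulE _ _).2.
move=> t; apply: cvgD; [apply: cvgD; apply: cvgM|exact: cvg_cst].
- exact: cR.
- exact: cy.
- exact: cI.
- exact: cx.
Qed.

Lemma continuous_sqr_cabs_horner (T : topologicalType) (x y : T -> R) P :
  continuous x -> continuous y ->
  continuous (fun t => cabs P.[Complex (x t) (y t)] ^+ 2).
Proof.
move=> cx cy; under eq_fun do rewrite sqr_cabs 2!expr2.
have [cR cI] := continuous_horner P cx cy.
by move=> t; apply: cvgD; apply: cvgM; [exact: cR|exact: cR|exact: cI|exact: cI].
Qed.

Lemma continuous_sqr_cabs_ratio (T : topologicalType) (x y : T -> R) P D t :
  continuous x -> continuous y -> D.[Complex (x t) (y t)] != 0 ->
  {for t, continuous (fun t => cabs (P.[Complex (x t) (y t)] / D.[Complex (x t) (y t)]) ^+ 2)}.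
Proof.
move=> cx cy D0; rewrite (_ : (fun _ => _) = fun t =>
  cabs P.[Complex (x t) (y t)] ^+ 2 * (cabs D.[Complex (x t) (y t)] ^+ 2)^-1); last first.
  by apply/funext => s; rewrite cabsM cabsV exprMn exprVn.
apply: cvgM; first exact: continuous_sqr_cabs_horner.
apply: cvgV; first by rewrite sqrf_eq0 cabs_eq0.
exact: continuous_sqr_cabs_horner.
Qed.

(** The disk is realised in ['rV[R]_2] as a closed subset of the square [[-1, 1]^2], hence compact.
    The squared modulus is maximised, since its continuity reduces to that of the two
    coordinates. *)
Lemma max_on_disk P D : (forall z, cabs z <= 1 -> D.[z] != 0) ->
  exists2 z0, cabs z0 <= 1 &
    forall z, cabs z <= 1 -> cabs (P.[z] / D.[z]) <= cabs (P.[z0] / D.[z0]).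
Proof.
move=> D0; pose x (v : 'rV[R]_2) := v 0 0; pose y (v : 'rV[R]_2) := v 0 1.
have cx : continuous x by exact: coord_continuous.
have cy : continuous y by exact: coord_continuous.
pose A := [set v : 'rV[R]_2 | cabs (Complex (x v) (y v)) ^+ 2 <= 1].
have AE v : A v -> cabs (Complex (x v) (y v)) <= 1.
  by rewrite /A /= => h; rewrite -(@ler_pXn2r _ 2) ?nnegrE ?cabs_ge0 // expr1n.
have EA v : cabs (Complex (x v) (y v)) <= 1 -> A v.
  by move=> h; rewrite /A /= expr_le1 ?cabs_ge0.
have cA : compact A.
  apply: (subclosed_compact (B := [set v : 'rV[R]_2 | forall i, `[-1, 1]%classic (v ord0 i)])).
  - apply: (closed_comp (f := fun v => cabs (Complex (x v) (y v)) ^+ 2) (D := [set t | t <= 1])).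
      have := continuous_sqr_cabs_horner (P := 'X) cx cy.
      by under eq_fun do rewrite hornerX; move=> c v _; exact: c.
    exact: closed_le.
  - exact: (@rV_compact R 2 (fun _ => `[-1, 1]%classic) (fun _ => @segment_compact R _ _)).
  - move=> v /=; rewrite /A /= sqr_cabs /= => v1 i; rewrite in_itv /= -ler_norml.
    rewrite -(@ler_pXn2r _ 2) ?nnegrE // expr1n real_normK ?num_real //.
    apply: le_trans v1; case: i => -[|[|//]] i2.
      by rewrite (_ : Ordinal i2 = 0) ?lerDl ?sqr_ge0 //; exact: val_inj.
    by rewrite (_ : Ordinal i2 = 1) ?lerDr ?sqr_ge0 //; exact: val_inj.
have A0 : A !=set0.
  by exists 0; apply: EA; rewrite /x /y !mxE (_ : Complex 0 0 = 0) // cabs0.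
have cf : {within A, continuous (fun v =>
    cabs (P.[Complex (x v) (y v)] / D.[Complex (x v) (y v)]) ^+ 2)}.
  apply: continuous_in_subspaceT => v; rewrite inE => /AE v1.
  by apply: continuous_sqr_cabs_ratio => //; exact: D0.
have [v vA vmax] := compact_EVT_max A0 cA cf.
exists (Complex (x v) (y v)); first by apply: AE; rewrite inE in vA.
case=> a b ab1; pose w : 'rV[R]_2 := \row_i (if i == 0 then a else b).
have wE : Complex (x w) (y w) = Complex a b by rewrite /x /y !mxE.
have := vmax w; rewrite inE => /(_ _); rewrite -wE in ab1 *.
by move=> /(_ (EA _ ab1)); rewrite ler_pXn2r ?nnegrE ?cabs_ge0.
Qed.

(* [P/D] minus its value [c] at [z0] is [(z - z0)^k] times a function that does
   not vanish at [z0], hence moving away from [z0] in a suitable direction adds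
   nearly a positive multiple of [c]. *)
Lemma no_local_max P D z0 : cabs z0 < 1 -> D.[z0] != 0 -> P.[z0] != 0 ->
  P * D.[z0]%:P != D * P.[z0]%:P ->
  exists2 z, cabs z < 1 & cabs (P.[z0] * D.[z]) < cabs (P.[z] * D.[z0]).
Proof.
move=> z01 Dz0 Pz0 neq; pose S := P * D.[z0]%:P - D * P.[z0]%:P.
have S0 : S != 0 by rewrite subr_eq0.
have [k [T]] := multiplicity_XsubC S z0; rewrite S0 /= => Tz0 SE.
have k0 : (0 < k)%N.
  rewrite lt0n; apply: contraNneq Tz0 => k0; rewrite /root.
  have /(congr1 (fun p => p.[z0])) := SE.
  by rewrite k0 expr0 mulr1 /S !hornerE /= mulrC subrr => <-.
rewrite /root in Tz0.
(* The direction of the move: with this [e], the value of [S] at [z0 + s e] is [s ^+ k * P.[z0]]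
   times that of [U], the multiple of [T] that agrees with [D] at [z0]. *)
have [e eE] : exists e : R[i], e ^+ k = P.[z0] * D.[z0] / T.[z0].
  have [e eE] := solve_monicpoly (fun i => if i == 0%N then P.[z0] * D.[z0] / T.[z0] else 0) k0.
  exists e; rewrite eE; case: k k0 {SE eE} => // k _; rewrite big_ord_recl big1 ?addr0 /=.
    by rewrite expr0 mulr1.
  by move=> i _; rewrite mul0r.
pose x (s : R) := Rez z0 + s * Rez e; pose y (s : R) := Imz z0 + s * Imz e.
have cx : continuous x.
  move=> s; apply: cvgD; first exact: cvg_cst.
  by apply: cvgM; [exact: cvg_id|exact: cvg_cst].
have cy : continuous y.
  move=> s; apply: cvgD; first exact: cvg_cst.
  by apply: cvgM; [exact: cvg_id|exact: cvg_cst].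
have xyE s : Complex (x s) (y s) = z0 + real_complex R s * e.
  rewrite /x /y; case: (z0) (e) => a b [c d].
  by apply/eqP; rewrite eq_complex /= !mul0r subr0 addr0 !eqxx.
pose U := (D.[z0] / T.[z0]) *: T.
have PUE s : P.[z0 + real_complex R s * e] * D.[z0] = P.[z0] *
    (D.[z0 + real_complex R s * e] + real_complex R (s ^+ k) * U.[z0 + real_complex R s * e]).
  set w := z0 + _; have /(congr1 (fun p => p.[w])) := SE.
  rewrite /S !hornerE /= [w - z0]addrC /w addKr -/w exprMn eE rmorphXn.
  move=> /eqP; rewrite subr_eq => /eqP ->. by field.
(* [phi] is the real part of [conjc D * U]. It governs the growth, as [|D + s^k U|^2 = |D|^2 + 2 s^k
   phi + s^(2k) |U|^2], and it equals [|D.[z0]|^2] at [s = 0]. *)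
pose phi s := Rez D.[Complex (x s) (y s)] * Rez U.[Complex (x s) (y s)]
            + Imz D.[Complex (x s) (y s)] * Imz U.[Complex (x s) (y s)].
have [cDR cDI] := continuous_horner D cx cy.
have [cUR cUI] := continuous_horner U cx cy.
have cphi : phi s @[s --> 0] --> phi 0.
  by apply: cvgD; apply: cvgM; [exact: cDR|exact: cUR|exact: cDI|exact: cUI].
have cw : cabs (Complex (x s) (y s)) ^+ 2 @[s --> 0] --> cabs (Complex (x 0) (y 0)) ^+ 2.
  have := @continuous_sqr_cabs_horner R x y 'X cx cy 0.
  by under eq_fun do rewrite hornerX.
have phi0 : 0 < phi 0.
  rewrite /phi xyE rmorph0 mul0r addr0 /U hornerZ divfK // -!expr2 -sqr_cabs.
  by rewrite exprn_gt0 // cabs_gt0.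
have w0 : cabs (Complex (x 0) (y 0)) ^+ 2 < 1.
  by rewrite xyE rmorph0 mul0r addr0 expr_lt1 ?cabs_ge0.
have [s [s0 phis ws]] : exists s : R, [/\ 0 < s, 0 < phi s & cabs (Complex (x s) (y s)) ^+ 2 < 1].
  have nphi : \forall s \near (0:R)^'+, 0 < phi s.
    exact: (cvgr_gt _ (cvg_at_right_filter cphi)).
  have nw : \forall s \near (0:R)^'+, cabs (Complex (x s) (y s)) ^+ 2 < 1.
    exact: (cvgr_lt _ (cvg_at_right_filter cw)).
  have ns : \forall s \near (0:R)^'+, 0 < s by exact: nbhs_right_gt.
  by have [s [? [? ?]]] := filter_ex (filterI ns (filterI nphi nw)); exists s.
exists (Complex (x s) (y s)).
  by move: ws; rewrite expr_lt1 ?cabs_ge0.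
move: phis; rewrite /phi !xyE PUE !cabsM.
move: (D.[_]) (U.[_]) => a u au.
rewrite ltr_pM2l ?cabs_gt0 //.
rewrite -(@ltr_pXn2r _ 2) ?nnegrE ?cabs_ge0 // !sqr_cabs.
have sk : 0 < s ^+ k by rewrite exprn_gt0.
case: a u au => a1 a2 [u1 u2] /= au; rewrite !mul0r subr0 addr0.
have := sqr_ge0 (s ^+ k * u1); have := sqr_ge0 (s ^+ k * u2).
have := mulr_gt0 sk au; nra.
Qed.

(** A maximum of [|P / D|] exceeding [g] cannot lie on the circle. At an interior point either
    [P / D] is constant, and its value at 1 contradicts the boundary bound, or [no_local_max]
    produces a larger value. *)
Lemma maximum_modulus_disk P D g : (forall z, cabs z <= 1 -> D.[z] != 0) ->
  (forall z, cabs z = 1 -> cabs P.[z] <= g * cabs D.[z]) ->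
  forall z, cabs z <= 1 -> cabs P.[z] <= g * cabs D.[z].
Proof.
move=> D0 Pg; have Dp z : cabs z <= 1 -> 0 < cabs D.[z] by move=> /D0; rewrite cabs_gt0.
have [z0 z01 zmax] := max_on_disk P D0.
suff le_g : cabs (P.[z0] / D.[z0]) <= g.
  by move=> z z1; rewrite -ler_pdivrMr ?Dp // -cabsV -cabsM (le_trans (zmax z z1)).
have g0 : 0 <= g.
  have := le_trans (cabs_ge0 _) (Pg 1 (cabs1 R)).
  by rewrite pmulr_lge0 // Dp // cabs1.
rewrite leNgt; apply/negP => lt_g.
have z0lt : cabs z0 < 1.
  rewrite lt_neqAle z01 andbT; apply/eqP => /Pg; rewrite -ler_pdivrMr ?Dp //.
  by rewrite -cabsV -cabsM leNgt lt_g.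
have P0 : P.[z0] != 0.
  by apply: contraTneq lt_g => ->; rewrite mul0r cabs0 -leNgt.
have [PD|neq] := eqVneq (P * D.[z0]%:P) (D * P.[z0]%:P).
  have /(congr1 (fun p => cabs p.[1])) := PD; rewrite !hornerM !hornerC !cabsM => E.
  have := Pg 1 (cabs1 R).
  rewrite -ler_pdivrMr ?Dp ?cabs1 // leNgt => /negP; apply; apply: lt_le_trans lt_g _.
  by rewrite cabsM cabsV ler_pdivrMr ?Dp // mulrAC ler_pdivlMr ?Dp ?cabs1 // E mulrC.
have [z z1] := no_local_max z0lt (D0 _ z01) P0 neq.
apply/negP; rewrite -leNgt !cabsM.
have z1' := ltW z1; have := zmax z z1'; rewrite !cabsM !cabsV ler_pdivrMr ?Dp //.
by rewrite mulrAC ler_pdivlMr ?Dp.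
Qed.

(** Inversion [w = z^-1] reduces this to the disk. Both polynomials are reversed at the degree [m]
    of [D], so the same factor [w ^+ m] cancels; the size hypothesis makes this legitimate for [P],
    and the reversed [D] takes the value [lead_coef D] at 0. *)
Lemma maximum_modulus_exterior P D g : (size P <= size D)%N ->
  (forall z, 1 <= cabs z -> D.[z] != 0) ->
  (forall z, cabs z = 1 -> cabs P.[z] <= g * cabs D.[z]) ->
  forall z, 1 <= cabs z -> cabs P.[z] <= g * cabs D.[z].
Proof.
move=> sPD D0 Pg; pose m := (size D).-1.
have D1 : D != 0.
  by apply: contraNneq (D0 1 _) => [->|]; rewrite ?horner0 ?cabs1.
have szD : size D = m.+1 by rewrite /m prednK // size_poly_gt0.
pose rev (p : {poly R[i]}) := \poly_(i < m.+1) p`_(m - i).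
have revE (p : {poly R[i]}) w : (size p <= m.+1)%N -> w != 0 -> (rev p).[w] = w ^+ m * p.[w^-1].
  move=> sp w0; rewrite horner_poly (horner_coef_wide _ sp) mulr_sumr.
  rewrite (reindex_inj rev_ord_inj) /=; apply: eq_bigr => i _.
  rewrite subSS subKn 1?leq_ord // mulrCA; congr (_ * _).
  by rewrite exprVn -exprB ?unitfE ?leq_ord.
have revD0 w : cabs w <= 1 -> (rev D).[w] != 0.
  have [-> _|w0 w1] := eqVneq w 0.
    rewrite horner_coef0 coef_poly subn0 /m -lead_coefE lead_coef_eq0.
    exact: D1.
  rewrite revE ?szD // mulf_neq0 ?expf_neq0 // D0 // cabsV.
  by rewrite invf_ge1 ?cabs_gt0.
have revP w : cabs w = 1 -> cabs (rev P).[w] <= g * cabs (rev D).[w].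
  move=> w1; have w0 : w != 0 by rewrite -cabs_eq0 w1 oner_neq0.
  rewrite !revE ?szD -?szD // !cabsM cabsX w1 expr1n !mul1r.
  by apply: Pg; rewrite cabsV w1 invr1.
move=> z z1; have z0 : z != 0 by rewrite -cabs_gt0 (lt_le_trans ltr01).
have zV : z^-1 != 0 by rewrite invr_eq0.
have := maximum_modulus_disk revD0 revP (z := z^-1).
rewrite !revE ?szD -?szD // invrK !cabsM mulrCA ler_pM2l ?cabs_gt0 ?expf_neq0 //.
by apply; rewrite cabsV invf_le1 ?cabs_gt0.
Qed.

End MaximumModulus.

(** * Small gain *)

Section SmallGain.
Variable R : realType.
Local Notation tofrac := (@FracField.tofrac {poly R}).
Local Notation cpoly := (map_poly (real_complex R)).

Lemma size_cpoly (p : {poly R}) : size (cpoly p) = size p.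
Proof. exact: size_map_poly. Qed.

(** The product of all reduced denominators, though not minimal, vanishes only where some entry has
    a pole. *)
Lemma common_denominator m n (G : 'M[ratfun R]_(m, n)) :
  exists d : {poly R}, exists N : 'I_m -> 'I_n -> {poly R},
  [/\ d != 0, forall i j, G i j = tofrac (N i j) / tofrac d &
      forall z, regular_mx (regular_at z) G -> (cpoly d).[z] != 0].
Proof.
pose d := \prod_(k : 'I_m * 'I_n) ratden (G k.1 k.2).
have d0 : d != 0 by apply/prodf_neq0 => k _; exact: ratden_neq0.
exists d; exists (fun i j => ratnum (G i j) * (d %/ ratden (G i j))); split=> //.
  move=> i j; rewrite {1}[G i j]ratfun_numden; apply/eqP.
  rewrite tofrac_div_eq ?ratden_neq0 // [_ * (ratnum _ * _)]mulrCA; apply/eqP.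
  congr (_ * _); rewrite mulrC divpK //.
  by rewrite /d (bigD1 (i, j)) //= dvdp_mulr.
move=> z Gz; rewrite /d rmorph_prod horner_prod; apply/prodf_neq0 => k _.
exact: Gz.
Qed.

(** For fixed [v] the form is a single fraction [P / d], with complex coefficients because [v] is
    complex. Cauchy-Schwarz bounds it on the circle, properness of [M] gives the size condition, and
    the exterior maximum principle does the rest. *)
Lemma ler_cabs_quadratic_form n (M : 'M[ratfun R]_n) (g : R) (v : 'cV[R[i]]_n) :
  Defs.proper M -> stable M ->
  (forall z, cabs z = 1 -> specnorm (evalmx M z) <= g) ->
  forall z, 1 <= cabs z ->
  cabs ((adjmx v *m evalmx M z *m v) 0 0) <= g * fronorm v ^+ 2.
Proof.
move=> pM sM Mg; have [d [N [d0 ME dz]]] := common_denominator M.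
pose P := \sum_i \sum_j (conjc (v i 0) * v j 0) *: cpoly (N i j).
have PE z : 1 <= cabs z ->
    P.[z] = (adjmx v *m evalmx M z *m v) 0 0 * (cpoly d).[z].
  move=> z1; have dz0 := dz z (sM z z1).
  rewrite -mulmxA mxE /P horner_sum mulr_suml; apply: eq_bigr => i _.
  rewrite horner_sum !mxE mulr_sumr mulr_suml; apply: eq_bigr => j _.
  rewrite hornerZ mxE (regular_evalP dz0 (ME i j)).2.
  by field.
have sP : (size P <= size (cpoly d))%N.
  rewrite size_cpoly; apply: leq_trans (size_sum _ _ _) _.
  apply/bigmax_leqP => i _; apply: leq_trans (size_sum _ _ _) _.
  apply/bigmax_leqP => j _; apply: leq_trans (size_scale_leq _ _) _.
  rewrite size_cpoly -(regular_ooE d0 (ME i j)); exact: (pM i j).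
have D0 z : 1 <= cabs z -> (cpoly d).[z] != 0 by move=> z1; apply: dz; exact: sM.
have PD z : cabs z = 1 -> cabs P.[z] <= g * fronorm v ^+ 2 * cabs (cpoly d).[z].
  move=> z1; rewrite PE ?z1 // cabsM ler_wpM2r ?cabs_ge0 // -mulmxA.
  apply: le_trans (cabs_adj_mulmx _ _) _.
  rewrite expr2 mulrCA ler_wpM2l ?fronorm_ge0 //.
  apply: le_trans (ler_specnorm_mulv _ _) _.
  by rewrite ler_wpM2r ?fronorm_ge0 // Mg.
move=> z z1; have := maximum_modulus_exterior sP D0 PD z1.
by rewrite PE // cabsM ler_pM2r // cabs_gt0 D0.
Qed.

(* An eigenvector [v] of [M z] for the eigenvalue [-1] with [cabs z >= 1] would
   give [v^* M(z) v = - |v|^2], against the maximum modulus principle. *)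
Lemma small_gain n (M : 'M[ratfun R]_n) (g : R) : zinvRHoo M -> g < 1 ->
  (forall z, cabs z = 1 -> specnorm (evalmx M z) <= g) ->
  1%:M + M \in unitmx /\ RHoo (invmx (1%:M + M)).
Proof.
move=> /zinvRHooP[spM sM] g1 Mg; have [U pI] := invmx_1Dstrictly_proper spM.
have /strictly_properP[pM _] := spM.
split=> //; apply/RHooP; split=> // z z1.
have s1 : stable (1%:M + M) by apply: stable_add => //; exact: stable1.
have [//|_ //] := place_invmx (place_at z) (s1 z z1).
(* [det0P] yields a row vector, that is, a left eigenvector; its adjoint [v] serves equally well,
   since [v^* M = - v^*] gives the same value of the form. *)
apply/det0P => -[w w0]; rewrite -/(evalmx _ z) evalmx_add ?evalmx1 //; last exact: stable1.
rewrite mulmxDr mulmx1 => /eqP; rewrite addrC addr_eq0 => /eqP wM.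
pose v := adjmx w; have wE : adjmx v = w by rewrite /v adjmxK.
have := @ler_cabs_quadratic_form _ M g v pM sM Mg z z1.
rewrite wE wM mulNmx -{1}wE mxE cabsN adj_mulmx cabs_real ger0_norm ?sqr_ge0 //.
have v0 : 0 < fronorm v ^+ 2.
  rewrite exprn_gt0 // lt_neqAle fronorm_ge0 andbT eq_sym.
  apply: contraNneq w0 => /fronorm_eq0 v0; rewrite -wE v0; apply/eqP.
  by apply/matrixP => i j; rewrite !mxE conjc0.
by rewrite leNgt gtr_pMl // g1.
Qed.

End SmallGain.

(** * Boundedness and comparison of the system norms *)

Section SystemNorms.
Variable R : realType.
Local Notation cpoly := (map_poly (real_complex R)).

Lemma ler_cabs_horner (p : {poly R[i]}) (z : R[i]) : cabs z = 1 ->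
  cabs p.[z] <= \sum_(i < size p) cabs p`_i.
Proof.
move=> z1; rewrite horner_coef; apply: le_trans (ler_cabs_sum _) _.
by apply: ler_sum => i _; rewrite cabsM cabsX z1 expr1n mulr1.
Qed.

(** All roots lie inside the disk, and on the circle each linear factor satisfies
    [|z - r| >= 1 - |r|]. *)
Lemma cabs_horner_lower_bound (p : {poly R[i]}) :
  (forall z, 1 <= cabs z -> p.[z] != 0) ->
  exists2 c : R, 0 < c & forall z, cabs z = 1 -> c <= cabs p.[z].
Proof.
move=> p0; have [s pE] := closed_field_poly_normal p.
have lc0 : lead_coef p != 0.
  rewrite lead_coef_eq0; apply: contraNneq (p0 1 _) => [->|]; by rewrite ?horner0 ?cabs1.
have s1 : forall r, r \in s -> cabs r < 1.
  move=> r rs; rewrite ltNge; apply/negP => /p0 /negP; apply.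
  by rewrite [X in X.[r]]pE -/(root _ _) rootZ // root_prod_XsubC.
suff [c c0 cE] : exists2 c : R, 0 < c &
    forall z, cabs z = 1 -> c <= cabs (\prod_(r <- s) ('X - r%:P)).[z].
  exists (cabs (lead_coef p) * c); first by rewrite mulr_gt0 ?cabs_gt0.
  by move=> z z1; rewrite [in leRHS]pE hornerZ cabsM ler_wpM2l ?cabs_ge0 ?cE.
elim: s s1 {pE} => [|r s IH] s1.
  by exists 1 => // z _; rewrite big_nil hornerC cabs1.
have [|c c0 cE] := IH; first by move=> t ts; rewrite s1 // inE ts orbT.
exists ((1 - cabs r) * c); first by rewrite mulr_gt0 // subr_gt0 s1 // mem_head.
move=> z z1; rewrite big_cons hornerM cabsM ler_pM ?cE ?(ltW c0) //.
  by rewrite subr_ge0 ltW // s1 // mem_head.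
rewrite hornerXsubC lerBlDr -z1; apply: le_trans (ler_cabsD _ _).
by rewrite subrK.
Qed.

Lemma rateval_bounded (f : ratfun R) : (forall z, 1 <= cabs z -> regular_at z f) ->
  exists c : R, forall z, cabs z = 1 -> cabs (rateval f z) <= c.
Proof.
move=> fz; have [c c0 cE] := cabs_horner_lower_bound fz.
exists ((\sum_(i < size (cpoly (ratnum f))) cabs (cpoly (ratnum f))`_i) / c) => z z1.
rewrite /rateval cabsM cabsV ler_pM ?invr_ge0 ?cabs_ge0 ?ler_cabs_horner //.
by rewrite lef_pV2 ?cE ?posrE // cabs_gt0; apply: fz; rewrite z1.
Qed.

(** A [sup] is known to dominate its set only once the set is bounded, so this is what gives
    [Hoonorm] its meaning for stable matrices. *)
Lemma specnorm_evalmx_bounded m n (G : 'M[ratfun R]_(m, n)) : stable G ->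
  has_ubound [set specnorm (evalmx G z) | z in [set z : R[i] | cabs z = 1]].
Proof.
move=> sG; have bd (k : 'I_m * 'I_n) : exists c : R,
    forall z, cabs z = 1 -> cabs (rateval (G k.1 k.2) z) <= c.
  by apply: rateval_bounded => z z1; exact: sG.
have [c cE] := choice bd.
exists (Num.sqrt (\sum_k c k ^+ 2)) => _ [z /= z1 <-].
apply: le_trans (specnorm_le_fronorm _) _; rewrite ler_wsqrtr // pair_bigA /=.
apply: ler_sum => k _; have := cE k z z1; rewrite mxE => h.
by rewrite ler_pXn2r ?nnegrE ?cabs_ge0 // (le_trans (cabs_ge0 _) h).
Qed.

Lemma specnorm_le_Hoonorm m n (G : 'M[ratfun R]_(m, n)) (z : R[i]) :
  stable G -> cabs z = 1 -> specnorm (evalmx G z) <= Hoonorm G.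
Proof.
by move=> sG z1; apply: ub_le_sup; [exact: specnorm_evalmx_bounded|exists z].
Qed.

Lemma Hoonorm_le m n (G : 'M[ratfun R]_(m, n)) (c : R) :
  (forall z, cabs z = 1 -> specnorm (evalmx G z) <= c) -> Hoonorm G <= c.
Proof.
move=> Gc; apply: ge_sup => [|_ [z /= z1 <-]]; last exact: Gc.
by exists (specnorm (evalmx G 1)); exists 1 => //=; rewrite cabs1.
Qed.

Lemma Hoonorm_ge0 m n (G : 'M[ratfun R]_(m, n)) : stable G -> 0 <= Hoonorm G.
Proof.
move=> sG; apply: le_trans (specnorm_ge0 (evalmx G 1)) _.
by apply: specnorm_le_Hoonorm => //; rewrite cabs1.
Qed.

Lemma cabs_circle (t : R) : cabs (Complex (cos t) (sin t)) = 1.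
Proof. by rewrite cabsE /= cos2Dsin2 sqrtr1. Qed.

Lemma continuous_sqr_fronorm_circle m n (G : 'M[ratfun R]_(m, n)) : stable G ->
  continuous (fun t : R => fronorm (evalmx G (Complex (cos t) (sin t))) ^+ 2).
Proof.
move=> sG; rewrite (_ : (fun _ => _) = fun t : R => \sum_(k : 'I_m * 'I_n)
    cabs (rateval (G k.1 k.2) (Complex (cos t) (sin t))) ^+ 2); last first.
  by apply/funext => t; rewrite sqr_fronorm_pair; apply: eq_bigr => k _; rewrite mxE.
apply: continuous_big => [|k _ t]; first exact: add_continuous.
apply: (@continuous_sqr_cabs_ratio R R cos sin _ _ t).
- exact: continuous_cos.
- exact: continuous_sin.
- by apply: (sG _ _ k.1 k.2); rewrite cabs_circle.
Qed.

Lemma integrable_sqr_fronorm_circle m n (G : 'M[ratfun R]_(m, n)) : stable G ->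
  (@lebesgue_measure R).-integrable `[- pi, pi]
    (EFin \o fun t : R => fronorm (evalmx G (Complex (cos t) (sin t))) ^+ 2).
Proof.
move=> sG; apply: continuous_compact_integrable; first exact: segment_compact.
by apply: continuous_subspaceT => t; exact: continuous_sqr_fronorm_circle.
Qed.

Lemma H2norm_le m n p q (G : 'M[ratfun R]_(m, n)) (H : 'M[ratfun R]_(p, q)) (c : R) :
  stable G -> stable H -> 0 <= c ->
  (forall z, cabs z = 1 -> fronorm (evalmx G z) <= c * fronorm (evalmx H z)) ->
  H2norm G <= c * H2norm H.
Proof.
move=> sG sH c0 GH; rewrite /H2norm -[X in _ <= X * _](ger0_norm c0) -sqrtr_sqr.
rewrite -sqrtrM ?sqr_ge0 // ler_wsqrtr // mulrCA.
rewrite ler_wpM2l ?invr_ge0 ?mulr_ge0 ?pi_ge0 //.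
have iH := integrable_sqr_fronorm_circle sH.
rewrite -RintegralZl //; apply: le_Rintegral => //.
- exact: integrable_sqr_fronorm_circle.
- exact: (integrableZl _ _ iH).
move=> t _ /=; rewrite -exprMn ler_pXn2r ?nnegrE ?mulr_ge0 ?fronorm_ge0 //.
by apply: GH; exact: cabs_circle.
Qed.

Lemma H2norm_ge0 m n (G : 'M[ratfun R]_(m, n)) : 0 <= H2norm G.
Proof. exact: sqrtr_ge0. Qed.

End SystemNorms.

(** * Robust synthesis and the true closed loop *)

Section RobustLQR.
Variable R : realType.

Lemma proper_zvar_scale m n (G : 'M[ratfun R]_(m, n)) :
  strictly_proper G -> Defs.proper (zvar R *: G).
Proof.
move=> sG i j; rewrite mxE; set f := G i j; have d0 := ratden_neq0 f.
have E : zvar R * f = FracField.tofrac (ratnum f * 'X) / FracField.tofrac (ratden f).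
  by rewrite {1}[f]ratfun_numden tofracM /zvar mulrA [X in X / _]mulrC.
rewrite -/(regular_oo _) (regular_ooE d0 E).
apply: leq_trans (size_polyMleq _ _) _; rewrite size_polyX addn2 /=.
exact: (sG i j).
Qed.

Lemma unitmx_invmx_mulr (n : nat) (C X : 'M[ratfun R]_n) : C *m X = 1%:M ->
  C \in unitmx /\ invmx C = X.
Proof.
move=> CX; have [Cu _] := mulmx1_unit CX; split=> //.
by rewrite -[LHS]mulmx1 -CX mulKmx.
Qed.

Variables n p : nat.
Implicit Types (A : 'M[R]_n) (B : 'M[R]_(n, p)) (Q : 'M[R]_n) (Rw : 'M[R]_p).
Implicit Types (Phix : 'M[ratfun R]_n) (Phiu : 'M[ratfun R]_(p, n)).

Lemma constmxD m k (M N : 'M[R]_(m, k)) : constmx (M + N) = constmx M + constmx N.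
Proof.
by apply/matrixP => i j; rewrite !mxE /ratC polyCD tofracD.
Qed.

Lemma constmxN m k (M : 'M[R]_(m, k)) : constmx (- M) = - constmx M.
Proof. by apply/matrixP => i j; rewrite !mxE /ratC polyCN tofracN. Qed.

Lemma constmxM m k l (M : 'M[R]_(m, k)) (N : 'M[R]_(k, l)) :
  constmx (M *m N) = constmx M *m constmx N.
Proof.
apply/matrixP => i j; rewrite !mxE /ratC !raddf_sum; apply: eq_bigr => h _.
by rewrite !mxE /= polyCM tofracM.
Qed.

Definition affine_identity A B Phix Phiu : Prop :=
  row_mx (zIminus (constmx A)) (- constmx B) *m col_mx Phix Phiu = 1%:M.

Lemma affine_identityE A B Phix Phiu : affine_identity A B Phix Phiu <->
  zvar R *: Phix = 1%:M + (constmx A *m Phix + constmx B *m Phiu).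
Proof.
rewrite /affine_identity mul_row_col /zIminus mulmxBl mul_scalar_mx mulNmx -addrA -opprD.
by split=> [/eqP|->]; [rewrite subr_eq => /eqP|rewrite addrK].
Qed.

(* [zvar *: Phix] is [1%:M] at infinity, which makes it invertible with a proper
   inverse. *)
Lemma proper_controller A B Phix Phiu : affine_identity A B Phix Phiu ->
  strictly_proper Phix -> strictly_proper Phiu ->
  Phix \in unitmx /\ Defs.proper (Phiu *m invmx Phix).
Proof.
move=> /affine_identityE E sx su; set S := constmx A *m _ + _ in E.
have sS : strictly_proper S.
  by apply: strictly_proper_add; apply: strictly_proper_mull => //; exact: proper_const.
have [Su pS] := invmx_1Dstrictly_proper sS.
have [Xu XE] : Phix \in unitmx /\ invmx Phix = zvar R *: invmx (1%:M + S).
  apply: unitmx_invmx_mulr; rewrite -scalemxAr scalemxAl E mulmxV //.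
(* The factor [zvar] of [invmx Phix] is not proper; it is moved onto [Phiu], whose strict properness
   absorbs it. *)
split=> //; rewrite XE -scalemxAr scalemxAl.
have [] // := place_mulmx (place_oo R) (proper_zvar_scale su) pS.
Qed.

Definition perturbation (dA : 'M[R]_n) (dB : 'M[R]_(n, p)) Phix Phiu :=
  constmx dA *m Phix + constmx dB *m Phiu.

Lemma zinvRHoo_perturbation dA dB Phix Phiu : zinvRHoo Phix -> zinvRHoo Phiu ->
  zinvRHoo (perturbation dA dB Phix Phiu).
Proof. by move=> sx su; apply: zinvRHoo_add; apply: zinvRHoo_mull_const. Qed.

(** The constraint is written for the estimates; with [K *m Phix = Phiu] it reads
    [closed_loop A B K *m Phix = 1 + D] for the true system, so the true responses are the designed
    ones times [invmx (1 + D)]. *)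
Lemma robust_response A B Ahat Bhat Phix Phiu (g : R) :
  affine_identity Ahat Bhat Phix Phiu -> zinvRHoo Phix -> zinvRHoo Phiu -> g < 1 ->
  let D := perturbation (Ahat - A) (Bhat - B) Phix Phiu in
  (forall z, cabs z = 1 -> specnorm (evalmx D z) <= g) ->
  let K := Phiu *m invmx Phix in
  [/\ stabilizes A B K, response_x A B K = Phix *m invmx (1%:M + D) &
      response_u A B K = Phiu *m invmx (1%:M + D)].
Proof.
move=> aff zx zu g1 D Dg K.
have [Xu pK] := proper_controller aff zx.2 zu.2.
have [Du RD] := small_gain (zinvRHoo_perturbation _ _ zx zu) g1 Dg.
have KX : K *m Phix = Phiu by rewrite /K (mulmxKV Xu).
have CX : closed_loop A B K *m Phix = 1%:M + D.
  rewrite /closed_loop /zIminus mulmxBl mul_scalar_mx mulmxDl -mulmxA KX.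
  have /affine_identityE -> := aff; rewrite /D /perturbation !constmxD !constmxN !mulmxDl !mulNmx.
  by rewrite -addrA; congr (_ + _); rewrite addrACA opprD.
have [Cu CE] : closed_loop A B K \in unitmx /\
    invmx (closed_loop A B K) = Phix *m invmx (1%:M + D).
  by apply: unitmx_invmx_mulr; rewrite mulmxA CX; exact: (mulmxV Du).
have xE : response_x A B K = Phix *m invmx (1%:M + D) by exact: CE.
have uE : response_u A B K = Phiu *m invmx (1%:M + D).
  by rewrite /response_u xE mulmxA KX.
split; [split; [exact: pK|exact: Cu| |]|exact: xE|exact: uE].
  by rewrite xE; exact: zinvRHoo_mulr zx RD.
by rewrite uE; exact: zinvRHoo_mulr zu RD.
Qed.

(** [Z = X - Z M] and the triangle inequality give [|Z| <= |X| + g |Z|]; no Neumann series is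
    involved. *)
Lemma contraction_bound m k (X Z : 'M[R[i]]_(m, k)) (M : 'M[R[i]]_k) (g : R) :
  specnorm M <= g -> g < 1 -> Z *m (1%:M + M) = X ->
  fronorm Z <= (1 - g)^-1 * fronorm X.
Proof.
move=> Mg g1 <-; rewrite ler_pdivlMl ?subr_gt0 // mulrBl mul1r lerBlDr.
rewrite {1}(_ : Z = Z *m (1%:M + M) - Z *m M); last by rewrite mulmxDr mulmx1 addrK.
apply: le_trans (ler_fronormD _ _) _; rewrite lerD2l fronormN.
apply: le_trans (ler_fronorm_mul_spec _ _) _.
by rewrite mulrC ler_wpM2r ?fronorm_ge0.
Qed.

Lemma contraction_bound_vec m (u v : 'cV[R[i]]_m) (M : 'M[R[i]]_m) (g : R) :
  specnorm M <= g -> g < 1 -> (1%:M + M) *m u = v ->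
  fronorm u <= (1 - g)^-1 * fronorm v.
Proof.
move=> Mg g1 <-; rewrite ler_pdivlMl ?subr_gt0 // mulrBl mul1r lerBlDr.
rewrite {1}(_ : u = (1%:M + M) *m u - M *m u); last by rewrite mulmxDl mul1mx addrK.
apply: le_trans (ler_fronormD _ _) _; rewrite lerD2l fronormN.
apply: le_trans (ler_specnorm_mulv _ _) _.
by rewrite ler_wpM2r ?fronorm_ge0.
Qed.

Lemma evalmx_1D_invmx m (M : 'M[ratfun R]_m) z :
  1%:M + M \in unitmx -> stable M -> stable (invmx (1%:M + M)) -> 1 <= cabs z ->
  (1%:M + evalmx M z) *m evalmx (invmx (1%:M + M)) z = 1%:M /\
  evalmx (invmx (1%:M + M)) z *m (1%:M + evalmx M z) = 1%:M.
Proof.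
move=> Mu sM sI z1; rewrite -(evalmx1 m z) -evalmx_add //; last exact: stable1.
have s1 : stable (1%:M + M) by apply: stable_add => //; exact: stable1.
by rewrite -!evalmx_mul // mulmxV // mulVmx.
Qed.

(** A right factor passes through the stacking and the weights, so the contraction bound holds
    pointwise on the circle and integrates. It serves twice: for the synthesized controller and for
    the static gain. *)
Lemma weighted_H2_mulr Q Rw Phix Phiu (M : 'M[ratfun R]_n) (g : R) :
  zinvRHoo Phix -> zinvRHoo Phiu -> zinvRHoo M -> g < 1 ->
  (forall z, cabs z = 1 -> specnorm (evalmx M z) <= g) ->
  weighted_H2 Q Rw (Phix *m invmx (1%:M + M)) (Phiu *m invmx (1%:M + M))
    <= (1 - g)^-1 * weighted_H2 Q Rw Phix Phiu.
Proof.
move=> /zinvRHooP[_ sx] /zinvRHooP[_ su] zM g1 Mg; rewrite /weighted_H2.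
have [Mu /RHooP[_ sN]] := small_gain zM g1 Mg.
have /zinvRHooP[_ sM] := zM.
have sW : stable (constmx (block_mx (sqrtmx Q) 0 0 (sqrtmx Rw)) *m col_mx Phix Phiu).
  by apply: stable_mulmx; [exact: stable_const|exact: stable_col_mx].
rewrite -mul_col_mx mulmxA; apply: H2norm_le => //.
- exact: stable_mulmx.
- by rewrite invr_ge0 subr_ge0 ltW.
move=> z z1; have z1' : 1 <= cabs z by rewrite z1.
apply: (contraction_bound (Mg z z1) g1).
by rewrite evalmx_mul // -mulmxA (evalmx_1D_invmx Mu sM sN z1').2 mulmx1.
Qed.

Lemma sqr_ratio_sqrt_half (e : R) : (e / Num.sqrt 2^-1) ^+ 2 = 2 * e ^+ 2.
Proof. by rewrite expr_div_n sqr_sqrtr ?invr_ge0 ?ler0n // invrK mulrC. Qed.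

Lemma half_compl : 1 - 2^-1 = 2^-1 :> R.
Proof. by field. Qed.

Lemma sqr_fronorm_scaled_response (a b : R) Phix Phiu (z : R[i]) (v : 'cV[R[i]]_n) :
  stable Phix -> stable Phiu -> 1 <= cabs z ->
  fronorm (evalmx (col_mx (ratC a *: Phix) (ratC b *: Phiu)) z *m v) ^+ 2 =
  a ^+ 2 * fronorm (evalmx Phix z *m v) ^+ 2 + b ^+ 2 * fronorm (evalmx Phiu z *m v) ^+ 2.
Proof.
move=> sx su z1; rewrite evalmx_col_mx !evalmx_scale // mul_col_mx fronorm_col_mx.
by rewrite -!scalemxAl !fronormZ !exprMn !cabs_real !real_normK ?num_real.
Qed.

(** The weights [1 / sqrt (1/2)] contribute the factor 2 of [(a + b)^2 <= 2 a^2 + 2 b^2], applied to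
    the two terms of the perturbation. *)
Lemma perturbation_bound dA dB (epsA epsB g : R) Phix Phiu :
  rspecnorm dA <= epsA -> rspecnorm dB <= epsB ->
  zinvRHoo Phix -> zinvRHoo Phiu ->
  Hoonorm (col_mx (ratC (epsA / Num.sqrt 2^-1) *: Phix)
                  (ratC (epsB / Num.sqrt (1 - 2^-1)) *: Phiu)) <= g ->
  forall z, cabs z = 1 -> specnorm (evalmx (perturbation dA dB Phix Phiu) z) <= g.
Proof.
move=> hA hB /zinvRHooP[_ sx] /zinvRHooP[_ su]; rewrite half_compl; set G := col_mx _ _.
move=> Gg z z1; have z1' : 1 <= cabs z by rewrite z1.
have sG : stable G by apply: stable_col_mx; exact: stable_scale.
have g0 : 0 <= g by apply: le_trans Gg; exact: Hoonorm_ge0.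
have A0 : 0 <= epsA by apply: le_trans hA; exact: specnorm_ge0.
have B0 : 0 <= epsB by apply: le_trans hB; exact: specnorm_ge0.
apply: specnorm_le_homo => // v.
have sc m k (M : 'M[R]_(m, k)) := stable_const M.
rewrite evalmx_add ?evalmx_mul ?evalmx_const //; try by apply: stable_mulmx.
rewrite mulmxDl -!mulmxA.
have := ler_specnorm_mulv (evalmx G z) v.
have Gz := le_trans (specnorm_le_Hoonorm sG z1) Gg.
move=> /le_trans /(_ (ler_wpM2r (fronorm_ge0 v) Gz)).
rewrite -(@ler_pXn2r _ 2) ?nnegrE ?mulr_ge0 ?fronorm_ge0 //.
rewrite sqr_fronorm_scaled_response // !sqr_ratio_sqrt_half => Gv.
apply: le_trans (ler_fronormD _ _) _.
set x := evalmx Phix z *m v in Gv *; set u := evalmx Phiu z *m v in Gv *.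
have xb : fronorm (map_mx (real_complex R) dA *m x) <= epsA * fronorm x.
  by apply: le_trans (ler_specnorm_mulv _ _) _; rewrite ler_wpM2r ?fronorm_ge0.
have ub : fronorm (map_mx (real_complex R) dB *m u) <= epsB * fronorm u.
  by apply: le_trans (ler_specnorm_mulv _ _) _; rewrite ler_wpM2r ?fronorm_ge0.
apply: le_trans (lerD xb ub) _.
rewrite -(@ler_pXn2r _ 2) ?nnegrE ?addr_ge0 ?mulr_ge0 ?fronorm_ge0 //.
apply: le_trans Gv.
have := sqr_ge0 (epsA * fronorm x - epsB * fronorm u).
by move: (fronorm x) (fronorm u) => a b; nra.
Qed.

Lemma closed_loop_const A B (K : 'M[R]_(p, n)) :
  closed_loop A B (constmx K) = zIminus (constmx (A + B *m K)).
Proof. by rewrite /closed_loop constmxD constmxM. Qed.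

Lemma zIminusB (M N : 'M[ratfun R]_n) : zIminus (M + N) = zIminus M - N.
Proof. by rewrite /zIminus opprD addrA. Qed.

(** * The static gain as a competitor for the estimated system *)

Section StaticGain.
Variables (A Ahat : 'M[R]_n) (B Bhat : 'M[R]_(n, p)) (K : 'M[R]_(p, n)).
Variables (epsA epsB : R).
Hypothesis hA : rspecnorm (Ahat - A) <= epsA.
Hypothesis hB : rspecnorm (Bhat - B) <= epsB.
Hypothesis Kstab : stabilizes A B (constmx K).

Local Notation Res := (resolvent (A + B *m K)).
Local Notation eps := (epsA + epsB * rspecnorm K).
Local Notation eta := (eps * Hoonorm Res).
Hypothesis eta_small : eta < 1.

(** True minus estimated closed-loop matrix: with this sign [zI - (Ahat + Bhat K) = (1 + M) (zI - (A
    + B K))]. *)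
Definition gain_mismatch := (A + B *m K) - (Ahat + Bhat *m K).
Local Notation M := (constmx gain_mismatch *m Res).

Lemma resolventE : response_x A B (constmx K) = Res.
Proof. by rewrite /response_x closed_loop_const. Qed.

Lemma unitmx_zIminus : zIminus (constmx (A + B *m K)) \in unitmx.
Proof. by have [_ + _ _] := Kstab; rewrite closed_loop_const. Qed.

Lemma zinvRHoo_resolvent : zinvRHoo Res.
Proof. by have [_ _ + _] := Kstab; rewrite resolventE. Qed.

Lemma zinvRHoo_mismatch : zinvRHoo M.
Proof. exact: zinvRHoo_mull_const zinvRHoo_resolvent. Qed.

Lemma stable_resolvent : stable Res.
Proof. by have /zinvRHooP[] := zinvRHoo_resolvent. Qed.

Lemma epsA_ge0 : 0 <= epsA.
Proof. by apply: le_trans hA; exact: specnorm_ge0. Qed.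

Lemma epsB_ge0 : 0 <= epsB.
Proof. by apply: le_trans hB; exact: specnorm_ge0. Qed.

Lemma rspecnorm_ge0 m k (N : 'M[R]_(m, k)) : 0 <= rspecnorm N.
Proof. exact: specnorm_ge0. Qed.

Lemma eps_ge0 : 0 <= eps.
Proof. by rewrite addr_ge0 ?mulr_ge0 ?rspecnorm_ge0 ?epsA_ge0 ?epsB_ge0. Qed.

Lemma eta_ge0 : 0 <= eta.
Proof. by rewrite mulr_ge0 ?eps_ge0 // Hoonorm_ge0 //; exact: stable_resolvent. Qed.

Lemma ler_rspecnorm_mulv m k (N : 'M[R]_(m, k)) (v : 'cV[R[i]]_k) :
  fronorm (map_mx (real_complex R) N *m v) <= rspecnorm N * fronorm v.
Proof. exact: ler_specnorm_mulv. Qed.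

Lemma fronorm_mismatch (v : 'cV[R[i]]_n) :
  fronorm (map_mx (real_complex R) gain_mismatch *m v) <= eps * fronorm v.
Proof.
rewrite (_ : gain_mismatch = - ((Ahat - A) + (Bhat - B) *m K)); last first.
  by rewrite /gain_mismatch mulmxBl addrACA -opprD opprB.
rewrite map_mxN mulNmx fronormN map_mxD map_mxM mulmxDl -mulmxA.
apply: le_trans (ler_fronormD _ _) _; rewrite mulrDl; apply: lerD.
  by apply: le_trans (ler_rspecnorm_mulv _ _) _; rewrite ler_wpM2r ?fronorm_ge0.
apply: le_trans (ler_rspecnorm_mulv _ _) _; rewrite -mulrA.
by apply: ler_pM; rewrite ?rspecnorm_ge0 ?fronorm_ge0 // ler_rspecnorm_mulv.
Qed.

Lemma specnorm_mismatch z : cabs z = 1 -> specnorm (evalmx M z) <= eta.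
Proof.
move=> z1; have z1' : 1 <= cabs z by rewrite z1.
apply: specnorm_le_homo => [|v]; first exact: eta_ge0.
rewrite evalmx_mul ?evalmx_const //; last exact: stable_resolvent; last exact: stable_const.
rewrite -mulmxA; apply: le_trans (fronorm_mismatch _) _; rewrite -mulrA.
rewrite ler_wpM2l ?eps_ge0 //; apply: le_trans (ler_specnorm_mulv _ _) _.
by rewrite ler_wpM2r ?fronorm_ge0 // specnorm_le_Hoonorm //; exact: stable_resolvent.
Qed.

Local Notation N := (invmx (1%:M + M)).
Local Notation Px := (Res *m N).
Local Notation Pu := (constmx K *m Res *m N).

Lemma static_small_gain : 1%:M + M \in unitmx /\ RHoo N.
Proof. exact: small_gain zinvRHoo_mismatch eta_small specnorm_mismatch. Qed.

(** By that factorization, [Px] and [Pu] are the responses of [K] on the estimated system. *)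
Lemma static_affine_identity : affine_identity Ahat Bhat Px Pu.
Proof.
have [Mu _] := static_small_gain.
rewrite /affine_identity mul_row_col mulNmx -!mulmxA (mulmxA (constmx Bhat)) -constmxM -mulmxBl.
rewrite -zIminusB -constmxD.
have -> : zIminus (constmx (Ahat + Bhat *m K)) =
    (1%:M + M) *m zIminus (constmx (A + B *m K)).
  rewrite mulmxDl mul1mx -mulmxA (mulVmx unitmx_zIminus) mulmx1.
  rewrite -[constmx gain_mismatch]opprK -zIminusB -constmxN -constmxD.
  by congr (zIminus (constmx _)); rewrite /gain_mismatch opprB [RHS]addrC subrK.
by rewrite -mulmxA (mulmxA (zIminus _)) (mulmxV unitmx_zIminus) mul1mx (mulmxV Mu).
Qed.

Lemma zinvRHoo_static : zinvRHoo Px /\ zinvRHoo Pu.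
Proof.
have [_ rN] := static_small_gain; have rR := zinvRHoo_resolvent.
split; first exact: zinvRHoo_mulr rR rN.
exact: zinvRHoo_mulr (zinvRHoo_mull_const _ rR) rN.
Qed.

(** The response to [v] has size [r <= |Res| |u|] with [|u| <= |v| / (1 - eta)], and the input is at
    most [|K| r]. Both weighted blocks together are then bounded by [sqrt 2 * eps * r]. *)
Lemma static_feasible : robust_feasible Ahat Bhat epsA epsB 2^-1
  (Num.sqrt 2 * eta / (1 - eta)) Px Pu.
Proof.
have [zx zu] := zinvRHoo_static.
have [/zinvRHooP[_ sx] /zinvRHooP[_ su]] := (zx, zu).
split=> //; first exact: static_affine_identity.
apply: Hoonorm_le => z z1; have z1' : 1 <= cabs z by rewrite z1.
have [Mu /RHooP[_ sN]] := static_small_gain.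
have /zinvRHooP[_ sM] := zinvRHoo_mismatch.
have sR := stable_resolvent.
have e0 := eta_ge0; have e1 : 0 <= (1 - eta)^-1 by rewrite invr_ge0 subr_ge0 ltW.
have c0 : 0 <= Num.sqrt 2 * eta / (1 - eta) by rewrite mulr_ge0 // mulr_ge0 ?sqrtr_ge0.
apply: specnorm_le_homo => // v.
rewrite -(@ler_pXn2r _ 2) ?nnegrE ?(mulr_ge0 c0 (fronorm_ge0 v)) ?fronorm_ge0 //.
rewrite half_compl sqr_fronorm_scaled_response // !sqr_ratio_sqrt_half.
set u := evalmx N z *m v; set r := fronorm (evalmx Res z *m u).
have xE : fronorm (evalmx Px z *m v) = r by rewrite evalmx_mul // -mulmxA.
have uE : fronorm (evalmx Pu z *m v) <= rspecnorm K * r.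
  rewrite -mulmxA evalmx_mul //; last exact: stable_const.
  rewrite evalmx_const evalmx_mul // -!mulmxA; exact: ler_rspecnorm_mulv.
have ub : fronorm u <= (1 - eta)^-1 * fronorm v.
  apply: (contraction_bound_vec (specnorm_mismatch z1) eta_small).
  by rewrite mulmxA (evalmx_1D_invmx Mu sM sN z1').1 mul1mx.
have rb : r <= Hoonorm Res * fronorm u.
  apply: le_trans (ler_specnorm_mulv _ _) _.
  by rewrite ler_wpM2r ?fronorm_ge0 // specnorm_le_Hoonorm.
have eb : eps * r <= eta / (1 - eta) * fronorm v.
  rewrite -!mulrA ler_wpM2l ?eps_ge0 //; apply: le_trans rb _.
  by rewrite ler_wpM2l ?Hoonorm_ge0.
have r0 : 0 <= r by exact: fronorm_ge0.
have er0 : 0 <= eps * r by rewrite mulr_ge0 ?eps_ge0.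
rewrite xE.
apply: (@le_trans _ _ (2 * (eps * r) ^+ 2)); last first.
  rewrite [leRHS](_ : _ = (Num.sqrt 2 * (eta / (1 - eta) * fronorm v)) ^+ 2).
    rewrite [leRHS]exprMn sqr_sqrtr ?ler0n // ler_wpM2l ?ler0n //.
    by rewrite ler_pXn2r ?nnegrE // (le_trans er0).
  by rewrite !mulrA.
have uE2 : fronorm (evalmx Pu z *m v) ^+ 2 <= (rspecnorm K * r) ^+ 2.
  by rewrite ler_pXn2r ?nnegrE ?mulr_ge0 ?rspecnorm_ge0 ?fronorm_ge0.
have A0 := epsA_ge0; have B0 := epsB_ge0; have k0 := rspecnorm_ge0 K.
apply: (@le_trans _ _ (2 * epsA ^+ 2 * r ^+ 2 + 2 * epsB ^+ 2 * (rspecnorm K * r) ^+ 2)).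
  by rewrite lerD2l ler_wpM2l // mulr_ge0 ?sqr_ge0.
(* The cross term of the squared sum is all that is given up here. *)
have cross : 0 <= epsA * r * (epsB * (rspecnorm K * r)) by rewrite !mulr_ge0.
rewrite (_ : _ + _ = 2 * (eps * r) ^+ 2 -
  4 * (epsA * r * (epsB * (rspecnorm K * r)))); last by ring.
by rewrite lerBlDr lerDl mulr_ge0.
Qed.

Lemma static_weighted_H2 Q Rw :
  weighted_H2 Q Rw Px Pu <= (1 - eta)^-1 *
    weighted_H2 Q Rw (response_x A B (constmx K)) (response_u A B (constmx K)).
Proof.
rewrite /response_u resolventE.
apply: weighted_H2_mulr eta_small specnorm_mismatch.
- exact: zinvRHoo_resolvent.
- exact: zinvRHoo_mull_const zinvRHoo_resolvent.
- exact: zinvRHoo_mismatch.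
Qed.

End StaticGain.

(** * Comparison of the costs *)

Lemma weighted_H2_ge0 Q Rw Phix Phiu : 0 <= weighted_H2 Q Rw Phix Phiu.
Proof. exact: H2norm_ge0. Qed.

(** The objective [weighted_H2 / (1 - gamma)] is exactly the quantity that bounds the true cost, so
    optimality transfers to the true system with no further loss. *)
Lemma robust_optimal_le Q Rw A B (epsA epsB gamma gamma' : R) Phix Phiu Phix' Phiu' :
  robust_optimal Q Rw A B epsA epsB 2^-1 gamma Phix Phiu -> 0 <= gamma' < 1 ->
  robust_feasible A B epsA epsB 2^-1 gamma' Phix' Phiu' ->
  (1 - gamma)^-1 * weighted_H2 Q Rw Phix Phiu <=
    (1 - gamma')^-1 * weighted_H2 Q Rw Phix' Phiu'.
Proof.
move=> [_ _ vE opt] g' feas.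
have : (robust_value Q Rw A B epsA epsB 2^-1 gamma' <= (weighted_H2 Q Rw Phix' Phiu')%:E)%E.
  by apply: ereal_inf_lbound; exists (Phix', Phiu').
move: (opt _ g'); rewrite -vE; move: (weighted_H2 Q Rw Phix Phiu) => w.
move: (weighted_H2 Q Rw Phix' Phiu') (robust_value _ _ _ _ _ _ _ _) => w' r le_opt le_r.
rewrite -lee_fin !EFinM; apply: (le_trans le_opt); apply: lee_wpmul2l => //.
by rewrite lee_fin invr_ge0 subr_ge0; case/andP: g' => _ /ltW.
Qed.

(** With [s = sqrt 2], the two denominators multiply to [1 - (1 + s) eta]. Cleared of it, the claim
    is [eta (4 - s - 5 (1 + s) eta) >= 0]; the bracket decreases in [eta] and equals [3 - 2 s >= 0]
    at [eta = 1/5]. *)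
Lemma suboptimality_constant (eta : R) : 0 <= eta -> eta <= 5^-1 ->
  0 <= Num.sqrt 2 * eta / (1 - eta) < 1 /\
  (1 - Num.sqrt 2 * eta / (1 - eta))^-1 * (1 - eta)^-1 <= 1 + 5 * eta.
Proof.
move=> e0 e5; set s := Num.sqrt 2.
have s0 : 0 <= s by exact: sqrtr_ge0.
have s2 : s ^+ 2 = 2 by rewrite sqr_sqrtr // ler0n.
have s3 : s <= 3 / 2 by nra.
have d0 : 0 < 1 - eta by lra.
have se : s * eta <= 3 / 2 * eta by nra.
have q0 : 0 < 1 - eta - s * eta by lra.
split.
  rewrite divr_ge0 ?mulr_ge0 ?(ltW d0) //= ltr_pdivrMr // mul1r; lra.
rewrite -invfM (_ : (1 - _) * _ = 1 - eta - s * eta); last by field; rewrite gt_eqF.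
rewrite -div1r ler_pdivrMr //.
have : 0 <= eta * (4 - s - 5 * (1 + s) * eta) by apply: mulr_ge0 => //; nra.
by nra.
Qed.

Lemma relative_error_le (J Jopt : \bar R) (j jopt c : R) :
  J = j%:E -> Jopt = jopt%:E -> 0 <= j -> 0 <= jopt -> 0 <= c ->
  j <= (1 + c) * jopt -> ((J - Jopt) / Jopt <= c%:E)%E.
Proof.
move=> -> -> j0 jopt0 c0 le_j; rewrite -EFinB inver.
(* For a zero optimal cost [j] vanishes too, and [0 * x = 0] in [\bar R] whatever the inverse of 0
   is. *)
have [jz|jnz] := eqVneq jopt 0.
  have -> : j = 0 by apply/eqP; rewrite eq_le j0 andbT (le_trans le_j) // jz mulr0.
  by rewrite jz subrr mul0e lee_fin.
have jp : 0 < jopt by rewrite lt_neqAle eq_sym jnz.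
by rewrite -EFinM lee_fin ler_pdivrMr //; lra.
Qed.

Lemma lqr_costE Q Rw A B (K : 'M[ratfun R]_(p, n)) : stabilizes A B K ->
  lqr_cost Q Rw A B K = (weighted_H2 Q Rw (response_x A B K) (response_u A B K))%:E.
Proof. by move=> stab; rewrite /lqr_cost (asboolT stab). Qed.

End RobustLQR.

Theorem theorem4p1 (R : realType) (n p : nat)
    (A : 'M[R]_n) (B : 'M[R]_(n, p)) (Q : 'M[R]_n) (Rw : 'M[R]_p)
    (hQ : posdefmx Q) (hR : posdefmx Rw)
    (Kstar : 'M[R]_(p, n))
    (hKstab : stabilizes A B (constmx Kstar))
    (hKopt : lqr_cost Q Rw A B (constmx Kstar) = lqr_opt Q Rw A B)
    (Ahat : 'M[R]_n) (Bhat : 'M[R]_(n, p)) (epsA epsB : R)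
    (hepsA : rspecnorm (Ahat - A) <= epsA)
    (hepsB : rspecnorm (Bhat - B) <= epsB)
    (gamma : R) (Phix : 'M[ratfun R]_n) (Phiu : 'M[ratfun R]_(p, n))
    (hopt : robust_optimal Q Rw Ahat Bhat epsA epsB 2^-1 gamma Phix Phiu)
    (hsmall : (epsA + epsB * rspecnorm Kstar)
                * Hoonorm (resolvent (A + B *m Kstar)) <= 5^-1) :
  ((lqr_cost Q Rw A B (Phiu *m invmx Phix) - lqr_opt Q Rw A B)
     / lqr_opt Q Rw A B
   <= (5 * ((epsA + epsB * rspecnorm Kstar)
              * Hoonorm (resolvent (A + B *m Kstar))))%:E)%E.
Proof.
have eta0 := eta_ge0 hepsA hepsB hKstab.
have eta1 : (epsA + epsB * rspecnorm Kstar) * Hoonorm (resolvent (A + B *m Kstar)) < 1.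
  by apply: le_lt_trans hsmall _; rewrite invf_lt1 ?ltr0n // ltr1n.
have [g'01 const] := suboptimality_constant eta0 hsmall.
have inv0 := ltW (etrans (invr_gt0 _) (etrans (subr_gt0 _ _) (andP g'01).2)).
have feas := static_feasible hepsA hepsB hKstab eta1.
have [/andP[g0 g1] [aff hoo zx zu] _ _] := hopt.
have [stab xE uE] := robust_response aff zx zu g1
  (perturbation_bound hepsA hepsB zx zu hoo).
have le1 := weighted_H2_mulr Q Rw zx zu (zinvRHoo_perturbation _ _ zx zu) g1
  (perturbation_bound hepsA hepsB zx zu hoo).
have le2 := robust_optimal_le hopt g'01 feas.
have le3 := static_weighted_H2 hepsA hepsB hKstab eta1 Q Rw.
have JE := lqr_costE Q Rw stab; rewrite xE uE in JE.
have JoptE := etrans (esym hKopt) (lqr_costE Q Rw hKstab).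
apply: (relative_error_le JE JoptE); [exact: weighted_H2_ge0|exact: weighted_H2_ge0| |].
  by rewrite mulr_ge0.
apply: (le_trans le1); apply: (le_trans le2).
apply: (le_trans (ler_wpM2l inv0 le3)); rewrite [leLHS]mulrA.
exact: (ler_wpM2r (weighted_H2_ge0 _ _ _ _) const).
Qed.
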